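(* Let $(x_*(\cdot),u_*(\cdot),\mathscr A_* )\in\mathscr A^{\mathcal M}_{\rm adm}\cap\mathscr A^{\mathcal M}_{\rm Lip}$. If $(x_*(\cdot),u_*(\cdot),\mathscr A_* )$ is a strong local minimum of the multiprocess problem $$J(x(\cdot),u(\cdot),\mathscr A)=\int_{t_0}^{t_1}\chi_{\mathscr A}(t)\circ f(t,x(t),u(t))\,dt\to\inf,\qquad \dot x(t)=\chi_{\mathscr A}(t)\circ\varphi(t,x(t),u(t)),\ x(t_0)=x_0,$$ $$u(t)\in U=U_1\times\dots\times U_k,\qquad \mathscr A\in\mathscr Z^k([t_0,t_1]),$$ then there exists a vector function $p(\cdot)\in PC_1([t_0,t_1],\mathbb R^n)$ such that (a) the adjoint equation $\dot p(t)=-H^{\mathcal M}_x(t,x_*(t),u_*(t),p(t),\mathscr A_* )$ holds on $[t_0,t_1]$; (b) at $t=t_1$ the transversality condition $p(t_1)=0$ holds; (c) at almost all points $t\in[t_0,t_1]$ the maximum condition $$H^{\mathcal M}(t,x_*(t),u_*(t),p(t),\mathscr A_* )=\max_{s\in\{1,\dots,k\}}\Big\{\max_{u_s\in U_s}H_s(t,x_*(t),u_s,p(t))\Big\}$$ holds.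
   Context: Function spaces. A function on $[a,b]$ is piecewise continuous if it is continuous except at finitely many points $a<s_1<\dots<s_N<b$, where both one-sided limits exist and are finite, and its values at the $s_i$ are chosen so that it is right-continuous. It is piecewise continuously differentiable if it is continuous on $[a,b]$, continuously differentiable on $(a,s_1),(s_1,s_2),\dots,(s_N,b)$ for finitely many such points, and its derivative is a piecewise continuous function on $[a,b]$, right-continuous at the $s_i$; $\dot x$ denotes this derivative. $PC([a,b],\mathbb R^n)$ and $PC_1([a,b],\mathbb R^n)$ are the corresponding spaces (componentwise); $PC([a,b],U)$ is the set of piecewise continuous functions with values in $U$. Decompositions. A piecewise composed interval is a finite (possibly empty) union of intervals $[a,b)$ and $[a,b]$ with $a<b$. A $k$-fold decomposition of an interval $I$ is a finite system $\mathscr A=\{\mathscr A_1,\dots,\mathscr A_k\}$ of pairwise disjoint piecewise composed intervals with $\bigcup_{s=1}^k\mathscr A_s=I$. $\mathscr Z^k(I)$ is the set of all of them. Write $\chi_{\mathscr A}(t)=(\chi_{\mathscr A_1}(t),\dots,\chi_{\mathscr A_k}(t))$ (characteristic functions), and for $h=(h_1,\dots,h_k)$ with $h_s=h_s(t,x,u_s)$ and $u=(u_1,\dots,u_k)$ put $\chi_{\mathscr A}(t)\circ h(t,x,u)=\sum_{s=1}^k\chi_{\mathscr A_s}(t)\,h_s(t,x,u_s)$. Data: $k\in\mathbb N$, an interval $[t_0,t_1]$, $x_0\in\mathbb R^n$, and for $s=1,\dots,k$: $f_s:\mathbb R\times\mathbb R^n\times\mathbb R^{m_s}\to\mathbb R$,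 $\varphi_s:\mathbb R\times\mathbb R^n\times\mathbb R^{m_s}\to\mathbb R^n$, $\emptyset\ne U_s\subseteq\mathbb R^{m_s}$; $f=(f_1,\dots,f_k)$, $\varphi=(\varphi_1,\dots,\varphi_k)$, $U=U_1\times\dots\times U_k$. $\mathscr A^{\mathcal M}_{\rm Lip}$ is the set of all triples $(x(\cdot),u(\cdot),\mathscr A)$ for which there is $\gamma>0$ such that for each $s=1,\dots,k$ the maps $f_s(t,x,u_s)$, $\varphi_s(t,x,u_s)$ are, on the set of all $(t,x,u_s)$ with $t\in[t_0,t_1]$, $\|x-x(t)\|<\gamma$, $u_s\in\mathbb R^{m_s}$, jointly continuous in all variables and continuously differentiable with respect to $x$. $\mathscr A^{\mathcal M}_{\rm adm}$ is the set of all $(x(\cdot),u(\cdot),\mathscr A)\in PC_1([t_0,t_1],\mathbb R^n)\times PC([t_0,t_1],U)\times\mathscr Z^k([t_0,t_1])$ satisfying $\dot x(t)=\chi_{\mathscr A}(t)\circ\varphi(t,x(t),u(t))$, $x(t_0)=x_0$. An admissible $(x_*(\cdot),u_*(\cdot),\mathscr A_* )$ is a strong local minimum if there is $\varepsilon>0$ such that $J(x(\cdot),u(\cdot),\mathscr A)\ge J(x_*(\cdot),u_*(\cdot),\mathscr A_* )$ for all $(x(\cdot),u(\cdot),\mathscr A)\in\mathscr A^{\mathcal M}_{\rm adm}$ with $\|x(\cdot)-x_*(\cdot)\|_\infty<\varepsilon$. Pontryagin functions: $H_s(t,x,u_s,p)=\langle p,\varphi_s(t,x,u_s)\rangle-f_s(t,x,u_s)$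 and $H^{\mathcal M}(t,x,u,p,\mathscr A)=\sum_{s=1}^k\chi_{\mathscr A_s}(t)\,H_s(t,x,u_s,p)$. *)

(* Defs.v *)
From HB Require Import structures.
From mathcomp Require Import all_boot all_order all_algebra.
From mathcomp Require Import all_classical all_reals all_analysis.

Set Implicit Arguments.
Unset Strict Implicit.
Unset Printing Implicit Defensive.

Import Order.TTheory GRing.Theory Num.Theory.
Import numFieldNormedType.Exports.

Local Open Scope classical_set_scope.
Local Open Scope ring_scope.

                                                                            
                                       

                                                                            
                                                                       
Definition pcontinuous_at (R : realType) (V : normedModType R) (a b : R)
    (s : seq R) (g : R -> V) : Prop :=
  [/\ forall c, c \in s -> a < c < b,
      forall t, a <= t <= b -> t \notin s ->
        g @ within `[a, b] (nbhs t) --> g t,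
      forall c, c \in s -> cvg (g @ c^'-) &
      forall c, c \in s -> g @ c^'+ --> g c].

Definition PC (R : realType) (V : normedModType R) (a b : R)
    (g : R -> V) : Prop :=
  exists s : seq R, pcontinuous_at a b s g.

                                                                               
                                                                           
                    
Definition PC1_derivative (R : realType) (V : normedModType R) (a b : R)
    (x xdot : R -> V) : Prop :=
  {within `[a, b], continuous x} /\
  exists2 s : seq R, pcontinuous_at a b s xdot &
    forall t, a < t < b -> t \notin s -> is_derive t 1 x (xdot t).

Definition pw_composed_interval (R : realType) (S : set R) : Prop :=
  exists2 l : seq (interval R),
    (forall i, i \in l ->
      exists2 ab : R * R, ab.1 < ab.2 &
        (i = `[ab.1, ab.2[%R) \/ (i = `[ab.1, ab.2]%R)) &
    S = [set t | exists2 i, i \in l & t \in i].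

Definition decomposition (R : realType) (k : nat) (I : set R)
    (A : 'I_k -> set R) : Prop :=
  [/\ forall s, pw_composed_interval (A s),
      forall s s', s != s' -> A s `&` A s' = set0 &
      \bigcup_s A s = I].

                           
Definition chi_comp (R : realType) (k n : nat) (m : 'I_k -> nat)
    (W : lmodType R) (A : 'I_k -> set R)
    (h : forall s : 'I_k, R -> 'rV[R]_n -> 'rV[R]_(m s) -> W)
    (t : R) (x : 'rV[R]_n) (u : forall s : 'I_k, 'rV[R]_(m s)) : W :=
  \sum_(s < k) \1_(A s) t *: h s t x (u s).

Definition tube (R : realType) (n q : nat) (t0 t1 gamma : R)
    (x : R -> 'rV[R]_n) : set (R * 'rV[R]_n * 'rV[R]_q) :=
  [set z | t0 <= z.1.1 <= t1 /\ `|z.1.2 - x z.1.1| < gamma].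

                                                                         
                                                                            
                                                                     
                    
Definition continuous_C1x (R : realType) (n q : nat) (W : normedModType R)
    (D : set (R * 'rV[R]_n * 'rV[R]_q))
    (h : R -> 'rV[R]_n -> 'rV[R]_q -> W) : Prop :=
  [/\ {within D, continuous (fun z => h z.1.1 z.1.2 z.2)},
      forall z, D z -> differentiable (fun y : 'rV[R]_n => h z.1.1 y z.2) z.1.2 &
      forall v : 'rV[R]_n, {within D, continuous
        (fun z : R * 'rV[R]_n * 'rV[R]_q =>
           'd (fun y : 'rV[R]_n => h z.1.1 y z.2) (z.1.2) v)}].

                                                                   
                                  
Definition lip (R : realType) (k n : nat) (m : 'I_k -> nat) (t0 t1 : R)
    (f : forall s : 'I_k, R -> 'rV[R]_n -> 'rV[R]_(m s) -> R)
    (phi : forall s : 'I_k, R -> 'rV[R]_n -> 'rV[R]_(m s) -> 'rV[R]_n)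
    (x : R -> 'rV[R]_n) : Prop :=
  exists2 gamma : R, 0 < gamma & forall s : 'I_k,
    continuous_C1x (tube t0 t1 gamma x) (f s) /\
    continuous_C1x (tube t0 t1 gamma x) (phi s).

Definition admissible (R : realType) (k n : nat) (m : 'I_k -> nat)
    (t0 t1 : R) (x0 : 'rV[R]_n)
    (phi : forall s : 'I_k, R -> 'rV[R]_n -> 'rV[R]_(m s) -> 'rV[R]_n)
    (U : forall s : 'I_k, set 'rV[R]_(m s))
    (x : R -> 'rV[R]_n) (u : R -> forall s : 'I_k, 'rV[R]_(m s))
    (A : 'I_k -> set R) : Prop :=
  [/\ exists2 xdot : R -> 'rV[R]_n, PC1_derivative t0 t1 x xdot &
        forall t, t0 <= t <= t1 -> xdot t = chi_comp A phi t (x t) (u t),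
      x t0 = x0,
      forall s, PC t0 t1 (fun t => u t s),
      forall t s, t0 <= t <= t1 -> U s (u t s) &
      decomposition `[t0, t1] A].

Definition cost (R : realType) (k n : nat) (m : 'I_k -> nat) (t0 t1 : R)
    (f : forall s : 'I_k, R -> 'rV[R]_n -> 'rV[R]_(m s) -> R)
    (x : R -> 'rV[R]_n) (u : R -> forall s : 'I_k, 'rV[R]_(m s))
    (A : 'I_k -> set R) : R :=
  \int[lebesgue_measure]_(t in `[t0, t1])
     chi_comp (W := R^o) A f t (x t) (u t).

Definition sup_dist (R : realType) (V : normedModType R) (a b : R)
    (x y : R -> V) : R :=
  sup [set `|x t - y t| | t in `[a, b]].

Definition strong_local_min (R : realType) (k n : nat) (m : 'I_k -> nat)
    (t0 t1 : R) (x0 : 'rV[R]_n)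
    (f : forall s : 'I_k, R -> 'rV[R]_n -> 'rV[R]_(m s) -> R)
    (phi : forall s : 'I_k, R -> 'rV[R]_n -> 'rV[R]_(m s) -> 'rV[R]_n)
    (U : forall s : 'I_k, set 'rV[R]_(m s))
    (xs : R -> 'rV[R]_n) (us : R -> forall s : 'I_k, 'rV[R]_(m s))
    (As : 'I_k -> set R) : Prop :=
  admissible t0 t1 x0 phi U xs us As /\
  exists2 eps : R, 0 < eps & forall x u A,
    admissible t0 t1 x0 phi U x u A -> sup_dist t0 t1 x xs < eps ->
    cost t0 t1 f xs us As <= cost t0 t1 f x u A.

Definition inner (R : realType) (n : nat) (p q : 'rV[R]_n) : R :=
  \sum_(i < n) p 0 i * q 0 i.

Definition gradient (R : realType) (n : nat) (g : 'rV[R]_n -> R)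
    (x : 'rV[R]_n) : 'rV[R]_n :=
  \row_(j < n) 'D_(delta_mx 0 j) g x.

Definition pontryagin (R : realType) (k n : nat) (m : 'I_k -> nat)
    (f : forall s : 'I_k, R -> 'rV[R]_n -> 'rV[R]_(m s) -> R)
    (phi : forall s : 'I_k, R -> 'rV[R]_n -> 'rV[R]_(m s) -> 'rV[R]_n)
    (s : 'I_k) (t : R) (x : 'rV[R]_n) (v : 'rV[R]_(m s)) (p : 'rV[R]_n) : R :=
  inner p (phi s t x v) - f s t x v.

Definition pontryaginM (R : realType) (k n : nat) (m : 'I_k -> nat)
    (f : forall s : 'I_k, R -> 'rV[R]_n -> 'rV[R]_(m s) -> R)
    (phi : forall s : 'I_k, R -> 'rV[R]_n -> 'rV[R]_(m s) -> 'rV[R]_n)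
    (t : R) (x : 'rV[R]_n) (u : forall s : 'I_k, 'rV[R]_(m s)) (p : 'rV[R]_n)
    (A : 'I_k -> set R) : R :=
  \sum_(s < k) \1_(A s) t * pontryagin f phi t x (u s) p.

Definition is_max (R : realType) (S : set R) (M : R) : Prop :=
  S M /\ forall y, S y -> y <= M.

(* Main.v *)
Require Import Defs.
From HB Require Import structures.
From mathcomp Require Import all_boot all_order all_algebra.
From mathcomp Require Import all_classical all_reals all_analysis.
From mathcomp Require Import measurable_realfun ring lra.
Set Implicit Arguments.
Unset Strict Implicit.
Unset Printing Implicit Defensive.
Import Order.TTheory GRing.Theory Num.Theory.
Import numFieldNormedType.Exports.
Local Open Scope classical_set_scope.
Local Open Scope ring_scope.

(** Needle variation. On a short window [[tau, tau + lam[] switch to the process [s]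
    with constant control [v]. By Picard iteration started at [xs] itself, the
    perturbed equation has a solution [x] with [|x - xs| <= K lam] on [[t0, t1]].
    Let [p] solve the linear adjoint equation backwards from [p(t1) = 0]. Since
    [<p, x - xs>] vanishes at both ends, the cost increment equals the integral of
      [- (H(t, x) - H(t, xs) - <H_x(t, xs), x - xs>)],
    where the first [H] uses the perturbed data and the others the original ones.
    Off the window this is a Taylor remainder, uniformly [o(lam)]; on the window
    it contributes [- lam (H_s(tau, v) - H^M(tau)) + o(lam)]. Nonnegativity of the
    increment gives [H_s(tau, v) <= H^M(tau)] at every [tau] outside a finite set.
    The variation of [x] itself is never computed. *)

(** * Increments and primitives with finitely many exceptional points *)

(** The needle displaces [x] by order [lam] after the window as well, so its indirect effect on the
    cost is as large as its direct one; subtracting [<p, x - xs>], whose total change is zero,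
    removes the indirect effect to first order. Since one needle changes the process and the control
    together, the maxima over [s] and over [u_s] are treated at once. All constants have to be fixed
    before [lam]. Regularity is given only in a tube around [xs], with controls ranging over a whole
    space, so uniformity comes from compactness of [[t0, t1]] times a ball that contains [v] and the
    values of [us], and every perturbed curve has to be kept inside the tube. Derivatives exist only
    off finitely many points; most estimates are therefore increment inequalities for continuous
    functions that are differentiable off a finite set. The half-open window suits both the right
    continuity of controls and the pieces allowed in a decomposition. *)

Lemma nondecreasing_off_finite (R : realType) (E : seq R) (f df : R -> R) (a b : R) :
  a <= b -> {within `[a, b], continuous f} ->
  (forall t, a < t < b -> t \notin E -> is_derive t 1 f (df t)) ->
  (forall t, a < t < b -> t \notin E -> 0 <= df t) -> f a <= f b.
Proof.
elim: E a b => [|c E IH] a b ab cf fd df0.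
  move: (ab); rewrite le_eqVlt => /predU1P[->//|ltab].
  have fd' t : t \in `]a, b[%R -> is_derive t 1 f (df t).
    by rewrite in_itv/= => tab; exact: fd.
  have [c cab fba] := MVT ltab fd' cf.
  rewrite -subr_ge0 fba mulr_ge0 ?subr_ge0//; exact: df0.
have [/andP[ac cb]|cab] := boolP (a < c < b).
  apply: (@le_trans _ _ (f c)); apply: IH.
  - exact: ltW.
  - by apply: continuous_subspaceW cf; apply: subset_itvl; rewrite bnd_simp ltW.
  - move=> t /andP[at_ tc] tE; apply: fd; rewrite ?at_ ?(lt_trans tc)//.
    by rewrite inE negb_or tE (lt_eqF tc).
  - move=> t /andP[at_ tc] tE; apply: df0; rewrite ?at_ ?(lt_trans tc)//.
    by rewrite inE negb_or tE (lt_eqF tc).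
  - exact: ltW.
  - by apply: continuous_subspaceW cf; apply: subset_itvr; rewrite bnd_simp ltW.
  - move=> t /andP[ct tb] tE; apply: fd; rewrite ?tb ?(lt_trans ac)//.
    by rewrite inE negb_or tE (gt_eqF ct).
  - move=> t /andP[ct tb] tE; apply: df0; rewrite ?tb ?(lt_trans ac)//.
    by rewrite inE negb_or tE (gt_eqF ct).
apply: IH => // t tab tE; [apply: fd|apply: df0] => //;
  rewrite inE negb_or tE andbT; apply: contraNneq cab => <- //.
Qed.

Lemma within_continuousD (R : realType) (T : topologicalType)
    (V : normedModType R) (A : set T) (f g : T -> V) :
  {within A, continuous f} -> {within A, continuous g} ->
  {within A, continuous (fun t => f t + g t)}.
Proof. by move=> cf cg t; apply: continuousD; [exact: cf|exact: cg]. Qed.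

Lemma within_continuousB (R : realType) (T : topologicalType)
    (V : normedModType R) (A : set T) (f g : T -> V) :
  {within A, continuous f} -> {within A, continuous g} ->
  {within A, continuous (fun t => f t - g t)}.
Proof. by move=> cf cg t; apply: continuousB; [exact: cf|exact: cg]. Qed.

Lemma increment_le_off_finite (R : realType) (E : seq R)
    (f df g dg : R -> R) (a b : R) : a <= b ->
  {within `[a, b], continuous f} -> {within `[a, b], continuous g} ->
  (forall t, a < t < b -> t \notin E -> is_derive t 1 f (df t)) ->
  (forall t, a < t < b -> t \notin E -> is_derive t 1 g (dg t)) ->
  (forall t, a < t < b -> t \notin E -> df t <= dg t) ->
  f b - f a <= g b - g a.
Proof.
move=> ab cf cg fd gd le_dfg.
suff : g a - f a <= g b - f b by lra.
apply: (@nondecreasing_off_finite _ E (fun t => g t - f t) (fun t => dg t - df t)) => //.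
- exact: within_continuousB.
- by move=> t tab tE; have := fd _ tab tE; have := gd _ tab tE => ? ?; exact: is_deriveB.
- by move=> t tab tE; rewrite subr_ge0; exact: le_dfg.
Qed.

Lemma norm_increment_le_off_finite (R : realType) (E : seq R)
    (f df g dg : R -> R) (a b : R) : a <= b ->
  {within `[a, b], continuous f} -> {within `[a, b], continuous g} ->
  (forall t, a < t < b -> t \notin E -> is_derive t 1 f (df t)) ->
  (forall t, a < t < b -> t \notin E -> is_derive t 1 g (dg t)) ->
  (forall t, a < t < b -> t \notin E -> `|df t| <= dg t) ->
  `|f b - f a| <= g b - g a.
Proof.
move=> ab cf cg fd gd le_dfg; rewrite ler_norml; apply/andP; split; last first.
  apply: (@increment_le_off_finite _ E f df g dg) => // t tab tE.
  by rewrite (le_trans (ler_norm _))// le_dfg.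
suff : (fun t => - f t) b - (fun t => - f t) a <= g b - g a by rewrite /=; lra.
apply: (@increment_le_off_finite _ E (fun t => - f t) (fun t => - df t) g dg) => //.
- by move=> t; apply: continuousN; exact: cf.
- by move=> t tab tE; have := fd _ tab tE => ?; exact: is_deriveN.
- by move=> t tab tE; rewrite (le_trans _ (le_dfg t tab tE))// -normrN ler_norm.
Qed.

Lemma affine_is_derive (R : realType) (c d t : R) :
  is_derive t 1 (fun t : R => c * t + d) c.
Proof.
have h := is_deriveD (is_deriveZ c (is_derive_id t 1)) (is_derive_cst d t 1).
by apply: (is_derive_eq h); rewrite addr0 -[LHS]/(c * 1) mulr1.
Qed.

Lemma affine_continuous (R : realType) (c d : R) : continuous (fun t : R => c * t + d).
Proof.
by move=> t; apply/differentiable_continuous/derivable1_diffP; have [] := affine_is_derive c d t.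
Qed.

(** Three increments are added, over [[a, c]], [[c, d]] and [[d, b]]. The bound [M] may be negative,
    and it is in the final estimate, where the window must produce a definite decrease; [0 <= eta]
    allows the outer length to be enlarged to [b - a]. *)
Lemma window_increment_le (R : realType) (E : seq R) (f df : R -> R)
    (a b c d M eta : R) : a <= c <= d -> d <= b -> 0 <= eta ->
  {within `[a, b], continuous f} ->
  (forall t, a < t < b -> t \notin E -> is_derive t 1 f (df t)) ->
  (forall t, c < t < d -> t \notin E -> df t <= M) ->
  (forall t, a < t < b -> t \notin E -> ~~ (c < t < d) -> df t <= eta) ->
  f b - f a <= M * (d - c) + eta * (b - a).
Proof.
move=> /andP[ac cd] db eta0 cf fd dfM dfeta.
have seg K p q : a <= p -> p <= q -> q <= b ->
    (forall t, p < t < q -> t \notin E -> df t <= K) ->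
    f q - f p <= K * (q - p).
  move=> ap pq qb dfK.
  have -> : K * (q - p) = (K * q + 0) - (K * p + 0) by ring.
  apply: (@increment_le_off_finite _ E f df (fun t => K * t + 0) (fun=> K)) => //.
  - by apply: continuous_subspaceW cf; apply: subset_itv; rewrite bnd_simp.
  - exact/continuous_subspaceT/affine_continuous.
  - move=> t /andP[pt tq]; apply: fd.
    by rewrite (le_lt_trans ap pt) (lt_le_trans tq qb).
  - by move=> t _ _; exact: affine_is_derive.
have cb := le_trans cd db; have ad := le_trans ac cd.
have s1 := seg eta a c (lexx _) ac cb.
have s2 := seg M c d ac cd db dfM.
have s3 := seg eta d b ad db (lexx _).
have {}s1 : f c - f a <= eta * (c - a).
  apply: s1 => t /andP[at_ tc] tE; apply: dfeta => //.
    by rewrite at_ (lt_le_trans tc cb).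
  by rewrite ltNge (ltW tc).
have {}s3 : f b - f d <= eta * (b - d).
  apply: s3 => t /andP[dt tb] tE; apply: dfeta => //.
    by rewrite tb (le_lt_trans ad dt).
  by rewrite [t < d]ltNge (ltW dt) andbF.
have : 0 <= eta * (d - c) by rewrite mulr_ge0 // subr_ge0.
nra.
Qed.

(** Weaker than [pcontinuous_at]: it keeps what integrability and the differentiation of primitives
    require, and unlike right continuity it survives the reversal of time. *)
Definition pw_bounded_continuous (R : realType) (V : normedModType R) (a b : R)
    (E : seq R) (g : R -> V) : Prop :=
  (exists M, forall t, a <= t <= b -> `|g t| <= M) /\
  (forall t, a < t < b -> t \notin E -> {for t, continuous g}).

Lemma finite_set_measurable_fun (R : realType) (F : set R) (g : R -> R) :
  finite_set F -> measurable_fun F g.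
Proof.
move=> finF mF Y mY; apply: countable_measurable; first by move=> t; exact: measurable_set1.
by apply: finite_set_countable; apply: sub_finite_set finF => t [].
Qed.

Lemma pw_bounded_continuous_integrable (R : realType) (a b : R) (E : seq R)
    (g : R -> R) : pw_bounded_continuous a b E g ->
  (@lebesgue_measure R).-integrable `[a, b] (EFin \o g).
Proof.
move=> [[M gM] gc]; apply: measurable_bounded_integrable => //.
- by rewrite /= lebesgue_measure_itv/=; case: ifP => //; rewrite -EFinB ltry.
(* On the open set [D] the function is continuous, hence measurable; what remains of [[a, b]] is
   finite. *)
- pose D := `]a, b[%classic `\` [set` E].
  have finF : finite_set (`[a, b] `\` D).
    apply: (@sub_finite_set _ _ ([set a; b] `|` [set` E])) => [t [/= tab /not_andP tD]|].
      move: tab; rewrite !in_itv/= => /andP[at_ tb].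
      have [tE|tE] := boolP (t \in E); first by right.
      left; case: tD; last by move/contrapT => tE'; rewrite tE' in tE.
      rewrite /= in_itv/= => /negP; rewrite negb_and -!leNgt => /orP[ta|bt].
        by left; apply/eqP; rewrite eq_le at_ ta.
      by right; apply/eqP; rewrite eq_le bt tb.
    by rewrite finite_setU; split; [exact: finite_set2|exact: finite_seq].
  have oD : open D.
    apply: openI; first exact: interval_open.
    by rewrite openC; apply: compact_closed => //; apply: finite_compact; exact: finite_seq.
  have -> : `[a, b]%classic = D `|` (`[a, b] `\` D).
    by rewrite setDUK// => t [/=]; rewrite !in_itv/= => /andP[/ltW -> /ltW ->].
  apply/measurable_funU.
  + by exact: open_measurable.
  + by apply: countable_measurable; [exact: measurable_set1|exact: finite_set_countable].
  split; last exact: finite_set_measurable_fun.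
  apply: open_continuous_measurable_fun => // t.
  by rewrite inE => -[/=]; rewrite in_itv/= => tab /negP; exact: gc.
- exists M; split; first exact: num_real.
  move=> K MK t /=; rewrite in_itv/= => tab.
  by rewrite (le_trans (gM t tab))// ltW.
Qed.

Lemma Rintegral_is_derive (R : realType) (a b : R) (E : seq R)
    (g : R -> R) (t : R) : pw_bounded_continuous a b E g -> a < t < b -> t \notin E ->
  is_derive t 1 (fun s => \int[lebesgue_measure]_(r in `[a, s]) g r) (g t).
Proof.
move=> pg /andP[at_ tb] tE.
have ig := pw_bounded_continuous_integrable pg.
have gt : {for t, continuous g} by apply: pg.2 => //; rewrite at_.
have [dG G'] := continuous_FTC1_closed tb ig at_ gt.
by apply: DeriveDef; [exact: dG|rewrite -derive1E; exact: G'].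
Qed.

Lemma Rintegral_within_continuous (R : realType) (a b : R) (E : seq R)
    (g : R -> R) : a <= b -> pw_bounded_continuous a b E g ->
  {within `[a, b], continuous (fun s => \int[lebesgue_measure]_(r in `[a, s]) g r)}.
Proof.
move=> ab pg; apply: parameterized_integral_continuous => //.
exact: pw_bounded_continuous_integrable pg.
Qed.

(** * Coordinatewise analysis of row vectors *)

Lemma rV_norm_le (R : realType) n (v : 'rV[R]_n) (c : R) :
  0 <= c -> (forall i, `|v 0 i| <= c) -> `|v| <= c.
Proof.
move=> c0 vc; rewrite [leLHS]/Num.Def.normr/= mx_normrE (bigmax_le _ c0)//= => -[i j] _ /=.
by rewrite ord1.
Qed.

Lemma rV_coord_le (R : realType) n (v : 'rV[R]_n) i : `|v 0 i| <= `|v|.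
Proof.
rewrite [leRHS]/Num.Def.normr/= mx_normrE; exact: (le_bigmax _ _ (0, i)).
Qed.

Lemma cvg_rV (R : realType) n (T : Type) (F : set_system T) (FF : Filter F)
    (f : T -> 'rV[R]_n) (l : 'rV[R]_n) :
  (forall i, (fun t => f t 0 i) @ F --> l 0 i) -> f @ F --> l.
Proof.
move=> fl; apply/cvgrPdist_le => /= e e0; near=> t.
apply: rV_norm_le (ltW e0) _ => i; rewrite !mxE.
by move: i; near: t; apply: filter_forall => i; exact: (cvgrPdist_le _ _).1 (fl i) e e0.
Unshelve. all: by end_near. Qed.

Lemma cvg_coord (R : realType) n (T : Type) (F : set_system T) (FF : Filter F)
    (f : T -> 'rV[R]_n) (l : 'rV[R]_n) i :
  f @ F --> l -> (fun t => f t 0 i) @ F --> l 0 i.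
Proof.
by move=> fl; exact: (cvg_comp _ (fun v : 'rV[R]_n => v 0 i) fl (@coord_continuous _ _ _ 0 i l)).
Qed.

Lemma is_derive_rV (R : realType) n (f : R -> 'rV[R]_n) (d : 'rV[R]_n) (t : R) :
  is_derive t 1 f d <-> forall i, is_derive t 1 (fun s => f s 0 i) (d 0 i).
Proof.
split=> [fd i|fd].
  have [/[dup] df /derivable_mxP dfi fdE] := fd.
  by apply: DeriveDef; [exact: dfi|rewrite -fdE (derive_mx df) mxE].
have df : derivable f t 1.
  by apply/derivable_mxP => i j; rewrite ord1; have [] := fd j.
apply: DeriveDef => //; rewrite derive_mx//; apply/rowP => i; rewrite mxE.
by have [] := fd i.
Qed.

Lemma within_continuous_coord (R : realType) n (T : topologicalType) (A : set T)
    (f : T -> 'rV[R]_n) i :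
  {within A, continuous f} -> {within A, continuous (fun t => f t 0 i)}.
Proof. by move=> cf t; apply: cvg_coord; exact: cf. Qed.

Lemma within_continuous_rV (R : realType) n (T : topologicalType) (A : set T)
    (f : T -> 'rV[R]_n) :
  (forall i, {within A, continuous (fun t => f t 0 i)}) -> {within A, continuous f}.
Proof. by move=> cf t; apply: cvg_rV => i; exact: cf. Qed.

(** The norm is the maximum of the coordinates, so the scalar inequality passes to vectors with no
    dimensional constant. *)
Lemma rV_increment_le (R : realType) n (E : seq R) (f df : R -> 'rV[R]_n)
    (g dg : R -> R) (a b : R) : a <= b ->
  {within `[a, b], continuous f} -> {within `[a, b], continuous g} ->
  (forall t, a < t < b -> t \notin E -> is_derive t 1 f (df t)) ->
  (forall t, a < t < b -> t \notin E -> is_derive t 1 g (dg t)) ->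
  (forall t, a < t < b -> t \notin E -> `|df t| <= dg t) ->
  `|f b - f a| <= g b - g a.
Proof.
move=> ab cf cg fd gd le_dfg; apply: rV_norm_le => [|i].
  (* Nonnegativity of the bound is shown separately: for [n = 0] no coordinate could provide it. *)
  rewrite subr_ge0; apply: (@nondecreasing_off_finite _ E g dg) => // t tab tE.
  by rewrite (le_trans _ (le_dfg t tab tE)).
rewrite !mxE.
apply: (@norm_increment_le_off_finite _ E (fun t => f t 0 i) (fun t => df t 0 i) g dg) => //.
- exact: within_continuous_coord.
- by move=> t tab tE; exact: (is_derive_rV f (df t) t).1 (fd t tab tE) i.
- by move=> t tab tE; rewrite (le_trans (rV_coord_le _ _))// le_dfg.
Qed.

Lemma pw_bounded_continuous_coord (R : realType) n (a b : R) (E : seq R)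
    (g : R -> 'rV[R]_n) i : pw_bounded_continuous a b E g ->
  pw_bounded_continuous a b E (fun t => g t 0 i).
Proof.
move=> [[M gM] gc]; split.
  by exists M => t tab; rewrite (le_trans (rV_coord_le _ _))// gM.
by move=> t tab tE; apply: cvg_coord; exact: gc.
Qed.

Definition primitive (R : realType) n (a : R) (g : R -> 'rV[R]_n) (t : R) : 'rV[R]_n :=
  \row_i \int[lebesgue_measure]_(r in `[a, t]) g r 0 i.

Lemma primitive_left (R : realType) n (a : R) (g : R -> 'rV[R]_n) : primitive a g a = 0.
Proof. by apply/rowP => i; rewrite !mxE set_itv1 Rintegral_set1. Qed.

Lemma primitive_is_derive (R : realType) n (a b : R) (E : seq R)
    (g : R -> 'rV[R]_n) (t : R) : pw_bounded_continuous a b E g -> a < t < b ->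
  t \notin E -> is_derive t 1 (primitive a g) (g t).
Proof.
move=> pg tab tE; apply/is_derive_rV => i.
rewrite (_ : (fun s => _) = fun s => \int[lebesgue_measure]_(r in `[a, s]) g r 0 i).
  exact: (Rintegral_is_derive (pw_bounded_continuous_coord i pg)).
by apply/funext => s; rewrite mxE.
Qed.

Lemma primitive_continuous (R : realType) n (a b : R) (E : seq R)
    (g : R -> 'rV[R]_n) : a <= b -> pw_bounded_continuous a b E g ->
  {within `[a, b], continuous (primitive a g)}.
Proof.
move=> ab pg; apply: within_continuous_rV => i.
rewrite (_ : (fun s => _) = fun s => \int[lebesgue_measure]_(r in `[a, s]) g r 0 i).
  exact: (Rintegral_within_continuous ab (pw_bounded_continuous_coord i pg)).
by apply/funext => s; rewrite mxE.
Qed.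

Lemma expR_affine_is_derive (R : realType) (c l d t : R) :
  is_derive t 1 (fun s => c * expR (l * s + d)) (c * (l * expR (l * t + d))).
Proof.
have h1 := affine_is_derive l d t.
have h2 := @is_derive1_comp _ expR (fun s => l * s + d) t _ _ (is_derive_expR _) h1.
by apply: (is_derive_eq (is_deriveZ c h2)); rewrite -[LHS]/(c * _) [X in c * X]mulrC.
Qed.

Lemma expR_affine_continuous (R : realType) (c l d : R) :
  continuous (fun s => c * expR (l * s + d)).
Proof.
move=> t; apply/differentiable_continuous/derivable1_diffP.
by have [] := expR_affine_is_derive c l d t.
Qed.

(** * Picard iteration near a reference curve *)

(** Besides convergence, the explicit rate is needed: it does not depend on the sequence, so it
    turns pointwise limits of the Picard iterates into uniform ones. *)
Lemma geometric_increments_cvg (R : realType) (V : completeNormedModType R)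
    (X : nat -> V) (C : R) : 0 <= C ->
  (forall j, `|X j.+1 - X j| <= C * 2^-1 ^+ j) ->
  exists l, forall j, `|l - X j| <= 2 * C * 2^-1 ^+ j.
Proof.
move=> C0 XC.
(* The factor [1 - 2^-m] makes the induction close: [2 * C * 2^-j * (1 - 2^-m)] is the exact sum of
   the [m] allowed increments after index [j]. *)
have tail m j : `|X (j + m)%N - X j| <= 2 * C * 2^-1 ^+ j * (1 - 2^-1 ^+ m).
  elim: m => [|m IH]; first by rewrite addn0 subrr normr0 expr0 subrr mulr0.
  rewrite addnS -(subrKA (X (j + m)%N)) (le_trans (ler_normD _ _))//.
  apply: (le_trans (lerD (XC _) IH)).
  rewrite exprD exprS; set p := _ ^+ j; set q := _ ^+ m; lra.
have : cvgn (series (telescope X)).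
  apply: normed_cvg; apply: (@series_le_cvg _ _ (geometric C 2^-1)).
  - by move=> j; exact: normr_ge0.
  - by move=> j /=; rewrite mulr_ge0// exprn_ge0.
  - exact: XC.
  - by apply: is_cvg_geometric_series; rewrite ger0_norm ?invr_ge0// invf_lt1 ?ltr1n.
rewrite telescopeK => /cvg_ex[l Xl]; exists (l + X 0%N) => j.
apply/ler_addgt0Pr => e e0.
have /cvgrPdist_lt/(_ e e0)[N _ XN] := Xl.
have /= := XN (j + N)%N (leq_addl _ _); rewrite opprB addrA => lXN.
rewrite -(subrKA (X (j + N)%N)) (le_trans (ler_normD _ _))// addrC lerD// ?(ltW lXN)//.
apply: le_trans (tail N j) _; by rewrite ler_piMr ?mulr_ge0 ?exprn_ge0// gerBl exprn_ge0.
Qed.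

Lemma rV_geometric_increments_cvg (R : realType) n (X : nat -> 'rV[R]_n) (C : R) :
  0 <= C -> (forall j, `|X j.+1 - X j| <= C * 2^-1 ^+ j) ->
  exists l, forall j, `|l - X j| <= 2 * C * 2^-1 ^+ j.
Proof.
move=> C0 XC.
have /choice[l lX] : forall i, exists l : R, forall j, `|l - X j 0 i| <= 2 * C * 2^-1 ^+ j.
  move=> i; apply: (@geometric_increments_cvg R R (fun j => X j 0 i)) => // j.
  apply: le_trans (XC j).
  by have := rV_coord_le (X j.+1 - X j) i; rewrite !mxE.
exists (\row_i l i) => j; apply: rV_norm_le => [|i]; last by rewrite !mxE.
by rewrite !mulr_ge0// exprn_ge0.
Qed.

Lemma uniform_limit_within_continuous (R : realType) (V : normedModType R) (A : set R)
    (X : nat -> R -> V) (x : R -> V) (C : R) :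
  (forall j, {within A, continuous (X j)}) ->
  (forall j t, A t -> `|x t - X j t| <= C * 2^-1 ^+ j) -> {within A, continuous x}.
Proof.
move=> cX xX; apply/subspace_continuousP => t At; apply/cvgrPdist_lt => /= e e0.
have h0 : geometric C 2^-1 @ \oo --> (0 : R).
  by apply: cvg_geometric; rewrite ger0_norm ?invr_ge0// invf_lt1 ?ltr1n.
have e3 : 0 < e / 3 by rewrite divr_gt0.
have /cvgrPdist_lt/(_ _ e3)[j _ /(_ j (leqnn _))] := h0.
rewrite /= sub0r normrN => /(le_lt_trans (ler_norm _)) Cj.
have /subspace_continuousP/(_ t At)/cvgrPdist_lt/(_ _ e3) nearX := cX j.
near=> s.
have As : A s by near: s; exact: withinT.
have Xs : `|X j t - X j s| < e / 3 by near: s.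
have -> : x t - x s = (x t - X j t) + (X j t - X j s) + (X j s - x s).
  by rewrite !subrKA.
have := xX j t At; have := xX j s As; have := Xs.
rewrite [`|x s - _|]distrC.
have := ler_normD ((x t - X j t) + (X j t - X j s)) (X j s - x s).
have := ler_normD (x t - X j t) (X j t - X j s).
lra.
Unshelve. all: by end_near. Qed.

Section Picard.
Context (R : realType) (n : nat) (a b : R) (E : seq R).
Variables (F : R -> 'rV[R]_n -> 'rV[R]_n) (xr : R -> 'rV[R]_n) (x0 : 'rV[R]_n).
Variables (L gam del : R).
Hypotheses (ab : a <= b) (L0 : 0 < L) (del0 : 0 <= del).
Hypothesis xr_cont : {within `[a, b], continuous xr}.
Hypothesis F_lip : forall t (y z : 'rV[R]_n), a <= t <= b -> `|y - xr t| <= gam ->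
  `|z - xr t| <= gam -> `|F t y - F t z| <= L * `|y - z|.
Hypothesis F_pw : forall y : R -> 'rV[R]_n, {within `[a, b], continuous y} ->
  (forall t, a <= t <= b -> `|y t - xr t| <= gam) ->
  pw_bounded_continuous a b E (fun t => F t (y t)).
Hypothesis xr_almost : forall t, a <= t <= b ->
  `|x0 + primitive a (fun s => F s (xr s)) t - xr t| <= del.
Hypothesis del_small : 2 * del * expR (2 * L * (b - a)) <= gam.

Let T (y : R -> 'rV[R]_n) (t : R) := x0 + primitive a (fun s => F s (y s)) t.
(* With this weight [T] contracts by 1/2 on all of [[a, b]], whatever its length. *)
Let W (t : R) := expR (2 * L * t + - (2 * L * a)).
Let near_xr (y : R -> 'rV[R]_n) := {within `[a, b], continuous y} /\
  forall t, a <= t <= b -> `|y t - xr t| <= gam.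

Let W_ge1 t : a <= t -> 1 <= W t.
Proof.
move=> at_; rewrite -expR0 ler_expR -mulrBr mulr_ge0 ?subr_ge0//.
by rewrite mulr_ge0// ltW.
Qed.

Let W_le t : t <= b -> W t <= expR (2 * L * (b - a)).
Proof.
by move=> tb; rewrite ler_expR -mulrBr ler_pM2l ?mulr_gt0// lerD2r.
Qed.

Let T_cont y : near_xr y -> {within `[a, b], continuous (T y)}.
Proof.
move=> [cy yx]; apply: within_continuousD.
  by apply: continuous_subspaceT => t; exact: cvg_cst.
exact: (primitive_continuous ab (F_pw cy yx)).
Qed.

Let T_is_derive y t : near_xr y -> a < t < b -> t \notin E ->
  is_derive t 1 (T y) (F t (y t)).
Proof.
move=> [cy yx] tab tE.
have h := primitive_is_derive (F_pw cy yx) tab tE.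
by apply: (is_derive_eq (is_deriveD (is_derive_cst x0 t 1) h)); rewrite add0r.
Qed.

(** The derivative of [c / 2 * W] is [L * (c * W)], which is the Lipschitz bound for
    [F t (y t) - F t (z t)]. Both images start from [x0], so the increment inequality is an estimate
    of the difference itself. *)
Let T_contraction y z c : near_xr y -> near_xr z -> 0 <= c ->
  (forall t, a <= t <= b -> `|y t - z t| <= c * W t) ->
  forall t, a <= t <= b -> `|T y t - T z t| <= c / 2 * W t.
Proof.
move=> Sy Sz c0 yz t /andP[at_ tb].
have Ta w : T w a = x0 by rewrite /T primitive_left addr0.
have : `|(T y t - T z t) - (T y a - T z a)| <= c / 2 * W t - c / 2 * W a.
  have sub : `[a, t] `<=` `[a, b] by apply: subset_itvl; rewrite bnd_simp.
  apply: (@rV_increment_le _ _ E (fun t => T y t - T z t) (fun t => F t (y t) - F t (z t))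
    (fun t => c / 2 * W t) (fun t => c / 2 * (2 * L * W t))) => //.
  - by apply: continuous_subspaceW sub _; apply: within_continuousB; exact: T_cont.
  - exact/continuous_subspaceT/expR_affine_continuous.
  - move=> s /andP[as_ st] sE; have sab : a < s < b by rewrite as_ (lt_le_trans st).
    by apply: is_deriveB; exact: T_is_derive.
  - by move=> s _ _; exact: expR_affine_is_derive.
  move=> s /andP[as_ st] sE.
  have sab : a <= s <= b by rewrite (ltW as_) (ltW (lt_le_trans st tb)).
  rewrite (le_trans (F_lip sab (Sy.2 s sab) (Sz.2 s sab)))//.
  have -> : c / 2 * (2 * L * W s) = L * (c * W s) by field.
  by rewrite ler_pM2l// yz.
rewrite !Ta subrr subr0 => /le_trans; apply.
by rewrite gerBl mulr_ge0 ?divr_ge0// expR_ge0.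
Qed.

Let X j := iter j T xr.

(** The three claims need one another: the contraction applies only to curves in the tube, and an
    iterate lies in the tube because its distance from [xr] is the sum of the earlier increments.
    The factor [2 * del * (1 - 2^-j)] is the partial sum of [del * 2^-i], and [del_small] keeps it
    below [gam] after multiplication by [W]. *)
Let X_spec j : [/\ {within `[a, b], continuous (X j)},
  forall t, a <= t <= b -> `|X j t - xr t| <= 2 * del * (1 - 2^-1 ^+ j) * W t &
  forall t, a <= t <= b -> `|X j.+1 t - X j t| <= del * 2^-1 ^+ j * W t].
Proof.
have tube i : (forall t, a <= t <= b -> `|X i t - xr t| <= 2 * del * (1 - 2^-1 ^+ i) * W t) ->
    {within `[a, b], continuous (X i)} -> near_xr (X i).
  move=> Xi cX; split=> // t /[dup] tab /andP[at_ tb].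
  rewrite (le_trans (Xi t tab))// (le_trans _ del_small)//.
  apply: ler_pM; rewrite ?expR_ge0 ?W_le//.
    by rewrite mulr_ge0 ?mulr_ge0// subr_ge0 exprn_ile1// ?invr_ge0// invf_le1 ?ler1n.
  by rewrite ler_piMr ?mulr_ge0// gerBl exprn_ge0.
elim: j => [|j [cX Xx XX]].
  split=> // [t tab|t /[dup] tab /andP[at_ _]].
    by rewrite /X/= subrr normr0 expr0 subrr mulr0 mul0r.
  rewrite expr0 mulr1 (le_trans (xr_almost tab))// ler_peMr//; exact: W_ge1.
have Xx' t : a <= t <= b -> `|X j.+1 t - xr t| <= 2 * del * (1 - 2^-1 ^+ j.+1) * W t.
  move=> tab; rewrite -(subrKA (X j t)) (le_trans (ler_normD _ _))//.
  apply: (le_trans (lerD (XX t tab) (Xx t tab))).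
  by rewrite -mulrDl ler_pM2r ?expR_gt0// exprS; set q := _ ^+ j; lra.
have cX' : {within `[a, b], continuous (X j.+1)} by exact: T_cont (tube j Xx cX).
split=> // t tab.
have -> : del * 2^-1 ^+ j.+1 = del * 2^-1 ^+ j / 2 by rewrite exprS; field.
by apply: (T_contraction (tube _ Xx' cX') (tube _ Xx cX)) => //; rewrite mulr_ge0// exprn_ge0.
Qed.

(** The distance of the solution from [xr] is proportional to the defect [del] of [xr] as a fixed
    point. For a needle this defect is of order [lam], which is where the size of the variation
    comes from. *)
Lemma picard : exists x : R -> 'rV[R]_n,
  [/\ {within `[a, b], continuous x}, x a = x0,
      forall t, a < t < b -> t \notin E -> is_derive t 1 x (F t (x t)) &
      forall t, a <= t <= b -> `|x t - xr t| <= 2 * del * expR (2 * L * (b - a))].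
Proof.
(* The iterates are controlled on [[a, b]] only; outside, the limit curve gets the default value
   0. *)
have /choice[x xP] : forall t, exists l, a <= t <= b ->
    forall j, `|l - X j t| <= 2 * (del * W t) * 2^-1 ^+ j.
  move=> t; have [tab|tab] := boolP (a <= t <= b); last by exists 0.
  have [||l lP] := @rV_geometric_increments_cvg R n (fun j => X j t) (del * W t).
  - by rewrite mulr_ge0// expR_ge0.
  - by move=> j; have [_ _ /(_ t tab)] := X_spec j; rewrite mulrAC.
  by exists l.
pose B := expR (2 * L * (b - a)).
have xX j t : a <= t <= b -> `|x t - X j t| <= 2 * del * B * 2^-1 ^+ j.
  move=> /[dup] tab /andP[at_ tb]; rewrite (le_trans (xP t tab j))//.
  by rewrite ler_wpM2r ?exprn_ge0// mulrA ler_wpM2l ?mulr_ge0// W_le.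
have cX j : {within `[a, b], continuous (X j)} by have [] := X_spec j.
have cx : {within `[a, b], continuous x}.
  apply: (uniform_limit_within_continuous cX (C := 2 * del * B)) => j t /=.
  by rewrite in_itv/=; exact: xX.
have xxr t : a <= t <= b -> `|x t - xr t| <= 2 * del * B.
  by move=> tab; have := xX 0%N t tab; rewrite expr0 mulr1.
have Sx : near_xr x.
  by split=> // t tab; rewrite (le_trans (xxr t tab)).
have SX j : near_xr (X j).
  have [cXj Xj _] := X_spec j; split=> // t /[dup] tab /andP[at_ tb].
  rewrite (le_trans (Xj t tab))// (le_trans _ del_small)//.
  apply: ler_pM; rewrite ?expR_ge0 ?W_le//.
    by rewrite mulr_ge0 ?mulr_ge0// subr_ge0 exprn_ile1// ?invr_ge0// invf_le1 ?ler1n.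
  by rewrite ler_piMr ?mulr_ge0// gerBl exprn_ge0.
(* Both [x] and [T x] are within a constant times [2^-j] of the iterate [X j.+1], for every [j]. *)
have xT t : a <= t <= b -> x t = T x t.
  move=> tab; apply/eqP; rewrite -subr_eq0 -normr_le0; apply/ler_addgt0Pr => e e0.
  have h0 : geometric (2 * del * B + del * B * B) 2^-1 @ \oo --> (0 : R).
    by apply: cvg_geometric; rewrite ger0_norm ?invr_ge0// invf_lt1 ?ltr1n.
  have /cvgrPdist_lt/(_ _ e0)[j _ /(_ j (leqnn _))] := h0.
  rewrite /= sub0r normrN => /(le_lt_trans (ler_norm _)) Cj.
  have /andP[at_ tb] := tab.
  have h1 := xX j.+1 t tab.
  have h2 : `|T (X j) t - T x t| <= 2 * del * B * 2^-1 ^+ j / 2 * W t.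
    apply: T_contraction => //; first by rewrite !mulr_ge0 ?exprn_ge0// expR_ge0.
    move=> s /[dup] sab /andP[as_ _]; rewrite distrC (le_trans (xX j s sab))//.
    by rewrite ler_peMr ?W_ge1// !mulr_ge0 ?exprn_ge0// expR_ge0.
  have h3 : 2 * del * B * 2^-1 ^+ j / 2 * W t <= del * B * B * 2^-1 ^+ j.
    have -> : del * B * B * 2^-1 ^+ j = 2 * del * B * 2^-1 ^+ j / 2 * B by field.
    by apply: ler_wpM2l (W_le tb); rewrite !mulr_ge0 ?exprn_ge0 ?expR_ge0.
  rewrite add0r -(subrKA (X j.+1 t)) (le_trans (ler_normD _ _))//.
  have dq0 : 0 <= del * B * 2^-1 ^+ j by rewrite !mulr_ge0 ?exprn_ge0 ?expR_ge0.
  rewrite (le_trans (lerD h1 (le_trans h2 h3)))// exprS.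
  apply: le_trans _ (ltW Cj); rewrite -subr_ge0.
  by rewrite (_ : _ - _ = del * B * 2^-1 ^+ j)//; field.
have aab : a <= a <= b by rewrite lexx.
exists x; split=> //; first by rewrite xT// /T primitive_left addr0.
move=> t tab tE; have tab' : t \in `]a, b[%R by rewrite in_itv.
have [dT TE] := T_is_derive Sx tab tE.
(* The fixed point equation holds on [[a, b]] alone, so the derivative of [T x] is carried over to
   [x] through a neighbourhood inside [(a, b)]. *)
have near_T : {near t, T x =1 x}.
  near=> s; rewrite xT//.
  have : s \in `]a, b[%R by near: s; exact: near_in_itvoo.
  by rewrite in_itv/= => /andP[/ltW -> /ltW ->].
exact: near_eq_is_derive near_T (T_is_derive Sx tab tE).
Unshelve. all: by end_near. Qed.
End Picard.

(** * Uniform estimates along a tube *)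

Section compact_uniformity.
Context (R : realType) (n q : nat) (t0 t1 gam M : R).
Variable G : R * 'rV[R]_n * 'rV[R]_q -> R.
Let D := [set z : R * 'rV[R]_n * 'rV[R]_q | t0 <= z.1.1 <= t1 /\ `|z.1.2| < gam].
Hypotheses (gam0 : 0 < gam) (G_cont : {within D, continuous G}).

(** This compact set parametrizes the slice [w = 0] of [D]. The set [D] itself is not compact, since
    [u] is unrestricted and [w] ranges over an open ball; hence the bound [M], and uniformity only
    near this slice. *)
Let K := [set z : R * 'rV[R]_q | t0 <= z.1 <= t1 /\ `|z.2| <= M].

Let K_compact : compact K.
Proof.
have -> : K = `[t0, t1]%classic `*` [set u : 'rV[R]_q | `|u| <= M].
  by apply/seteqP; split=> -[t u] /=; rewrite in_itv.
apply: compact_setX; first exact: segment_compact.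
apply: bounded_closed_compact.
  exists M; split; first exact: num_real.
  by move=> c Mc u /= uM; rewrite (le_trans uM)// ltW.
rewrite (_ : [set u | _] = (fun u : 'rV[R]_q => `|u|) @^-1` [set r | r <= M])//.
apply: closed_comp; last exact: closed_le.
by move=> u _; exact: norm_continuous.
Qed.

Let G_near (t : R) (u : 'rV[R]_q) (eta : R) : t0 <= t <= t1 -> 0 < eta -> exists2 e : R, 0 < e &
  forall t' w u', t0 <= t' <= t1 -> `|w| < gam -> `|t - t'| < e -> `|w| < e ->
    `|u - u'| < e -> `|G (t, 0, u) - G (t', w, u')| < eta.
Proof.
move=> tI eta0.
have Dt : D (t, 0, u) by split; rewrite //= normr0.
have /subspace_continuousP/(_ _ Dt)/cvgrPdist_lt/(_ _ eta0) := G_cont.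
rewrite near_withinE => /nbhs_ballP[e /= e0 eG]; exists e => // t' w u' tI' wg tt' we uu'.
apply: (eG (t', w, u')); last by [].
suff [[b1 b2] b3] : (ball t e t' /\ ball (0 : 'rV[R]_n) e w) /\ ball u e u' by [].
by rewrite -!ball_normE /ball_/= sub0r normrN.
Qed.

Lemma compact_slice_bounded : exists2 C : R, 0 <= C &
  forall t u, t0 <= t <= t1 -> `|u| <= M -> `|G (t, 0, u)| <= C.
Proof.
have /compact_near_coveringP/near_covering_withinP := K_compact.
move=> /(_ R (pinfty_nbhs R) (fun C z => `|G (z.1, 0, z.2)| <= C) _).
move=> covK; suff nearK : \forall C \near pinfty_nbhs R,
    K `<=` (fun z => `|G (z.1, 0, z.2)| <= C).
  near (pinfty_nbhs R) => C; exists C; first by near: C; exact: nbhs_pinfty_ge.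
  move=> t u tI uM; have CK : K `<=` (fun z => `|G (z.1, 0, z.2)| <= C) by near: C.
  exact: (CK (t, u)).
apply: covK => -[t u] [/= tI uM].
have [e e0 eG] := G_near u tI ltr01.
exists (ball (t, u) e, [set C | `|G (t, 0, u)| + 1 <= C]).
  by split; [exact: nbhsx_ballx|exact: nbhs_pinfty_ge].
move=> [[t' u'] C] [[/= tt' uu'] C1] [/= tI' uM'].
rewrite (le_trans _ C1)//.
have := eG t' 0 u' tI'; rewrite normr0 => /(_ gam0 tt' e0).
rewrite -ball_normE /ball_/= in uu' => /(_ uu').
have := ler_normD (G (t, 0, u)) (G (t', 0, u') - G (t, 0, u)).
by rewrite subrKC [`|G (t', _, _) - _|]distrC; lra.
Unshelve. all: by end_near. Qed.

(** Compactness is used in its near-covering form, with [w] as the parameter tending to 0: the radii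
    that depend on the point of [K] are replaced by a single one. *)
Lemma compact_slice_uniform (eta : R) : 0 < eta -> exists2 rho : R, 0 < rho < gam &
  forall t u w, t0 <= t <= t1 -> `|u| <= M -> `|w| <= rho ->
    `|G (t, w, u) - G (t, 0, u)| <= eta.
Proof.
move=> eta0.
have /compact_near_coveringP/near_covering_withinP := K_compact.
move=> /(_ 'rV[R]_n (nbhs (0 : 'rV[R]_n))
  (fun w z => `|G (z.1, w, z.2) - G (z.1, 0, z.2)| <= eta) _).
move=> covK.
have /nbhs_ballP[e /= e0 eK] : \forall w \near (0 : 'rV[R]_n), K `<=`
    (fun z => `|G (z.1, w, z.2) - G (z.1, 0, z.2)| <= eta).
  apply: covK.
  move=> [t u] [/= tI uM].
  have eta2 : 0 < eta / 2 by rewrite divr_gt0.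
  have [e e0 eG] := G_near u tI eta2.
  exists (ball (t, u) e, ball 0 (Num.min e gam)).
    by split; apply: nbhsx_ballx; rewrite // lt_min e0.
  move=> [[t' u'] w] /= [[/= tt' uu']]; rewrite -!ball_normE /ball_/= in uu' *.
  rewrite sub0r normrN lt_min => /andP[we wg] [/= tI' uM'].
  have h1 := eG t' w u' tI' wg tt' we uu'.
  have := eG t' 0 u' tI'; rewrite normr0 => /(_ gam0 tt' e0 uu') h2.
  rewrite -(subrKA (G (t, 0, u))) (le_trans (ler_normD _ _))//.
  by move: h1; rewrite distrC => h1; lra.
have m0 : 0 < Num.min e gam by rewrite lt_min e0.
have [m_e m_gam] : Num.min e gam <= e /\ Num.min e gam <= gam.
  by rewrite !ge_min !lexx orbT.
(* Halving fits the closed ball of radius [rho] into the open ball obtained above, and keeps [rho]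
   below [gam]. *)
exists (Num.min e gam / 2); first by apply/andP; split; lra.
move=> t u w tI uM wr; apply: (eK w _ (t, u)) => //=.
by rewrite -ball_normE /ball_/= sub0r normrN; lra.
Qed.
End compact_uniformity.

(** * Mean value, Lipschitz and Taylor estimates in a tube *)

Lemma cvg_within_comp (T : Type) (U W : topologicalType) (F : set_system T)
    (FF : Filter F) (B : set U) (f : T -> U) (g : U -> W) (l : U) :
  {within B, continuous g} -> B l -> f @ F --> l -> (\forall t \near F, B (f t)) ->
  g (f t) @[t --> F] --> g l.
Proof.
move=> /subspace_continuousP cg Bl fl Bf; apply: cvg_comp (cg l Bl) => P.
rewrite /within/= => nP; have H : F (f @^-1` (fun z => B z -> P z)) := fl _ nP.
by apply: filterS2 H Bf => t; exact.
Qed.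

Lemma within_continuous_comp (T U W : topologicalType) (A : set T) (B : set U)
    (f : T -> U) (g : U -> W) :
  {within A, continuous f} -> (forall t, A t -> B (f t)) ->
  {within B, continuous g} -> {within A, continuous (g \o f)}.
Proof.
move=> /subspace_continuousP cf AB cg; apply/subspace_continuousP => t At.
apply: (cvg_within_comp _ cg (AB t At) (cf t At)).
by near=> s; apply: AB; near: s; exact: withinT.
Unshelve. all: by end_near. Qed.

Lemma diff_rV_expand (R : realType) n (W : normedModType R) (g : 'rV[R]_n -> W)
    (y v : 'rV[R]_n) : 'd g y v = \sum_j v 0 j *: 'd g y (delta_mx 0 j).
Proof.
by rewrite [in LHS](row_sum_delta v) linear_sum; apply: eq_bigr => j _; rewrite linearZ.
Qed.

(** The equality form of the mean value theorem is available for real values only; vector-valued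
    right-hand sides are therefore handled coordinate by coordinate. *)
Lemma segment_mean_value (R : realType) n (g : 'rV[R]_n -> R) (y d : 'rV[R]_n) :
  (forall r : R, 0 <= r <= 1 -> differentiable g (y + r *: d)) ->
  exists2 r : R, 0 <= r <= 1 & g (y + d) - g y = 'd g (y + r *: d) d.
Proof.
move=> dg; pose aff (r : R) := y + r *: d.
have affd (r : R) : is_derive r 1 aff d.
  apply/is_derive_rV => i.
  rewrite (_ : (fun s => _) = fun s => d 0 i * s + y 0 i).
    exact: affine_is_derive.
  by apply/funext => s; rewrite !mxE; ring.
have gd (r : R) : 0 <= r <= 1 -> is_derive r 1 (g \o aff) ('d g (aff r) d).
  move=> r01; have dr := dg r r01; have [/derivable1_diffP da dae] := affd r.
  have dga : differentiable (g \o aff) r by exact: differentiable_comp.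
  apply: DeriveDef; first exact/derivable1_diffP.
  by rewrite deriveE// diff_comp//= -dae deriveE.
have [||r r01] := @MVT_segment R (g \o aff) (fun r => 'd g (aff r) d) 0 1 ler01.
- by move=> r; rewrite in_itv/= => /andP[r0 r1]; apply: gd; rewrite !ltW.
- apply: continuous_in_subspaceT => r; rewrite inE/= in_itv/= => r01.
  by apply/differentiable_continuous/derivable1_diffP; have [] := gd r r01.
rewrite in_itv/= in r01; rewrite /= /aff scale1r scale0r addr0 subr0 mulr1 => gE.
by exists r.
Qed.

Section tube_estimates.
Context (R : realType) (n q : nat) (t0 t1 gam M : R).
Variables (x : R -> 'rV[R]_n) (h : R -> 'rV[R]_n -> 'rV[R]_q -> R).
Hypotheses (gam0 : 0 < gam) (x_cont : {within `[t0, t1], continuous x}).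
Hypothesis h_C1 : continuous_C1x (tube t0 t1 gam x) h.

Let D := [set z : R * 'rV[R]_n * 'rV[R]_q | t0 <= z.1.1 <= t1 /\ `|z.1.2| < gam].
Let dh (t : R) (u : 'rV[R]_q) (y v : 'rV[R]_n) : R := 'd (fun y => h t y u) y v.

Let dh_expand t u y v : dh t u y v = \sum_j v 0 j * dh t u y (delta_mx 0 j).
Proof. exact: diff_rV_expand. Qed.

(** Writing [y = x t + w] straightens the moving tube into the domain [D], whose constraint on [w]
    no longer depends on [t]. *)
Let G (v : 'rV[R]_n) (z : R * 'rV[R]_n * 'rV[R]_q) : R :=
  dh z.1.1 z.2 (x z.1.1 + z.1.2) v.

Let GE v t w u : G v (t, w, u) = dh t u (x t + w) v.
Proof. exact: erefl. Qed.

Let G0E v t u : G v (t, 0, u) = dh t u (x t) v.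
Proof. by rewrite GE addr0. Qed.

Let dh_cont (v : 'rV[R]_n) : {within D, continuous (G v)}.
Proof.
have [_ _ /(_ v) ch] := h_C1.
pose f (z : R * 'rV[R]_n * 'rV[R]_q) : R * 'rV[R]_n * 'rV[R]_q := (z.1.1, x z.1.1 + z.1.2, z.2).
pose g (z : R * 'rV[R]_n * 'rV[R]_q) : R :=
  'd (fun y : 'rV[R]_n => h z.1.1 y z.2) (z.1.2) v.
suff : {within D, continuous (g \o f)} by [].
apply: (within_continuous_comp (B := tube t0 t1 gam x)) => //.
- apply/subspace_continuousP => z Dz.
  have c11 : z0.1.1 @[z0 --> within D (nbhs z)] --> z.1.1.
    apply: cvg_within_filter.
    by apply: (@cvg_comp _ _ _ fst fst); [exact: cvg_fst|exact: cvg_fst].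
  have c12 : z0.1.2 @[z0 --> within D (nbhs z)] --> z.1.2.
    apply: cvg_within_filter.
    by apply: (@cvg_comp _ _ _ fst snd); [exact: cvg_fst|exact: cvg_snd].
  have c2 : z0.2 @[z0 --> within D (nbhs z)] --> z.2.
    by apply: cvg_within_filter; exact: cvg_snd.
  have cx : x z0.1.1 @[z0 --> within D (nbhs z)] --> x z.1.1.
    apply: (cvg_within_comp _ x_cont) c11 _; first by rewrite /= in_itv/=; case: Dz.
    near=> z0; have : D z0 by near: z0; exact: withinT.
    by case=> + _; rewrite /= in_itv.
  exact: (cvg_pair (cvg_pair c11 (cvgD cx c12)) c2).
- by move=> z [zI zg]; split => //=; rewrite addrC addKr.
Unshelve. all: by end_near. Qed.

(** The derivative is assumed continuous for each fixed direction. Bounding it in the basis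
    directions and summing makes the bound uniform in [v]. *)
Lemma tube_derivative_bounded : exists2 C : R, 0 <= C &
  forall t (u : 'rV[R]_q) v, t0 <= t <= t1 -> `|u| <= M ->
    `|dh t u (x t) v| <= C * `|v|.
Proof.
have /choice[C CP] : forall j : 'I_n, exists C : R, 0 <= C /\
    forall t (u : 'rV[R]_q), t0 <= t <= t1 -> `|u| <= M ->
    `|dh t u (x t) (delta_mx 0 j)| <= C.
  move=> j; have [C C0 CP] := compact_slice_bounded M gam0 (@dh_cont (delta_mx 0 j)).
  by exists C; split; [exact: C0|move=> t u tI uM; rewrite -G0E; exact: CP].
exists (\sum_j C j).
  by apply: sumr_ge0 => j _; case: (CP j).
move=> t u v tI uM; rewrite dh_expand; apply: le_trans (ler_norm_sum _ _ _) _.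
rewrite mulr_suml ler_sum// => j _; rewrite normrM mulrC ler_pM//.
  by have [_] := CP j; exact.
exact: rV_coord_le.
Qed.

Lemma tube_derivative_uniform (eta : R) : 0 < eta -> exists2 rho : R, 0 < rho < gam &
  forall t (u : 'rV[R]_q) w v, t0 <= t <= t1 -> `|u| <= M -> `|w| <= rho ->
    `|dh t u (x t + w) v - dh t u (x t) v| <= eta * `|v|.
Proof.
(* Each of the [n] basis directions receives an equal share of [eta]; dividing by [n.+1] also covers
   [n = 0]. *)
move=> eta0; pose eta' := eta / n.+1%:R.
have eta'0 : 0 < eta' by rewrite divr_gt0.
have /choice[rho rhoP] : forall j : 'I_n, exists rho : R, 0 < rho < gam /\
    forall t (u : 'rV[R]_q) w, t0 <= t <= t1 -> `|u| <= M -> `|w| <= rho ->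
    `|dh t u (x t + w) (delta_mx 0 j) - dh t u (x t) (delta_mx 0 j)| <= eta'.
  move=> j; have [rho r0 rP] := compact_slice_uniform M gam0 (@dh_cont (delta_mx 0 j)) eta'0.
  by exists rho; split; [exact: r0|move=> t u w tI uM wr; rewrite -G0E -GE; exact: rP].
have rho0 j : 0 < rho j by have [/andP[]] := rhoP j.
pose r := \big[Num.min/(gam / 2)]_j rho j.
have r0 : 0 < r by apply: lt_bigmin => //; rewrite divr_gt0.
exists r.
  apply/andP; split=> //; apply: le_lt_trans (bigmin_le_id _ _ _ _) _.
  by rewrite ltr_pdivrMr// ltr_pMr// ltr1n.
move=> t u w v tI uM wr.
rewrite (dh_expand t u (x t + w)) (dh_expand t u (x t)) -sumrB.
apply: le_trans (ler_norm_sum _ _ _) _.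
apply: (@le_trans _ _ (\sum_(j < n) eta' * `|v|)).
  apply: ler_sum => j _; rewrite -mulrBr normrM mulrC ler_pM//.
    have [_ H] := rhoP j; apply: H => //.
    by rewrite (le_trans wr)// bigmin_le_cond.
  exact: rV_coord_le.
rewrite sumr_const card_ord -mulr_natl mulrA ler_wpM2r// /eta' mulrA ler_pdivrMr//.
by rewrite mulrC ler_pM2l// ler_nat.
Qed.

Let h_diff t u y : t0 <= t <= t1 -> `|y - x t| < gam ->
  differentiable (fun y => h t y u) y.
Proof. by move=> tI yg; have [_ /(_ (t, y, u)) H _] := h_C1; apply: H. Qed.

(** Balls are convex, so the segment from [z] to [y] stays in the tube. The intermediate point is
    returned as a displacement [w] from [x t], the form in which the uniform estimates are
    stated. *)
Lemma tube_mean_value t (u : 'rV[R]_q) (y z : 'rV[R]_n) rho : t0 <= t <= t1 -> rho < gam ->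
  `|y - x t| <= rho -> `|z - x t| <= rho ->
  exists2 w, `|w| <= rho & h t y u - h t z u = dh t u (x t + w) (y - z).
Proof.
move=> tI rg yr zr.
have conv (r : R) : 0 <= r <= 1 -> `|z + r *: (y - z) - x t| <= rho.
  move=> /andP[r0 r1].
  have -> : z + r *: (y - z) - x t = (1 - r) *: (z - x t) + r *: (y - x t).
    by apply/rowP => i; rewrite !mxE; ring.
  rewrite (le_trans (ler_normD _ _))// !normrZ !ger0_norm ?subr_ge0//.
  have -> : rho = (1 - r) * rho + r * rho by ring.
  by rewrite lerD// ler_wpM2l// subr_ge0.
have [r01 r01P] := @segment_mean_value R n (fun y => h t y u) z (y - z)
  (fun r r01 => @h_diff t u _ tI (le_lt_trans (conv r r01) rg)).
rewrite subrKC => ->; exists (z + r01 *: (y - z) - x t); first exact: conv.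
by rewrite [x t + _]addrC subrK.
Qed.

(** In a thin enough tube the derivative differs by at most 1 from its value on the curve, which is
    bounded by [C]; this gives the constant [C + 1]. *)
Lemma tube_lipschitz : exists2 C : R, 0 <= C & exists2 rho : R, 0 < rho < gam &
  forall t (u : 'rV[R]_q) y z, t0 <= t <= t1 -> `|u| <= M ->
    `|y - x t| <= rho -> `|z - x t| <= rho -> `|h t y u - h t z u| <= C * `|y - z|.
Proof.
have [C C0 CP] := tube_derivative_bounded.
have [rho /andP[rho0 rg] rhoP] := tube_derivative_uniform ltr01.
exists (C + 1); first lra.
exists rho; first by rewrite rho0.
move=> t u y z tI uM yr zr.
have [w wr ->] := tube_mean_value u tI rg yr zr.
have := CP t u (y - z) tI uM; have := rhoP t u w (y - z) tI uM wr.
move: (dh t u (x t) _) => p; move: (dh t u (x t + w) _) => r rp pC.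
have := ler_normD p (r - p); rewrite subrKC mulrDl => /le_trans; apply.
by rewrite addrC [leRHS]addrC lerD.
Qed.

Lemma tube_taylor (eta : R) : 0 < eta -> exists2 rho : R, 0 < rho < gam &
  forall t (u : 'rV[R]_q) y, t0 <= t <= t1 -> `|u| <= M -> `|y - x t| <= rho ->
    `|h t y u - h t (x t) u - dh t u (x t) (y - x t)| <= eta * `|y - x t|.
Proof.
move=> eta0; have [rho /andP[rho0 rg] rhoP] := tube_derivative_uniform eta0.
exists rho; first by rewrite rho0.
move=> t u y tI uM yr.
have xr : `|x t - x t| <= rho by rewrite subrr normr0 ltW.
have [w wr ->] := tube_mean_value u tI rg yr xr.
exact: rhoP.
Qed.
End tube_estimates.

(** * Piecewise continuous functions *)

Section piecewise_continuity.
Context (R : realType) (V : normedModType R) (a b : R).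

Lemma at_right_within_itv t : a <= t < b -> within `[a, b] (nbhs t) `<=` t^'+.
Proof.
move=> /andP[at_ tb] P; rewrite /within/= => nP.
near=> s; have h : `[a, b]%classic s -> P s by near: s; exact: cvg_at_right_filter nP.
apply: h; rewrite /= in_itv/=; apply/andP; split.
  by rewrite (le_trans at_)//; near: s; exact: nbhs_right_ge.
by near: s; exact: nbhs_right_le.
Unshelve. all: by end_near. Qed.

Lemma at_left_within_itv t : a < t <= b -> within `[a, b] (nbhs t) `<=` t^'-.
Proof.
move=> /andP[at_ tb] P; rewrite /within/= => nP.
near=> s; have h : `[a, b]%classic s -> P s by near: s; exact: cvg_at_left_filter nP.
apply: h; rewrite /= in_itv/=; apply/andP; split.
  by near: s; exact: nbhs_left_ge.
by rewrite (le_trans _ tb)//; near: s; exact: nbhs_left_le.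
Unshelve. all: by end_near. Qed.

(** In terms of one-sided limits, right continuity and left limits are required everywhere and [s]
    only exempts points from left continuity. So [s] may be enlarged by interior points, which lets
    several functions share one exceptional list. *)
Lemma pcontinuous_atP (s : seq R) (g : R -> V) : pcontinuous_at a b s g <->
  [/\ forall c, c \in s -> a < c < b,
      forall t, a <= t < b -> g @ t^'+ --> g t,
      forall t, a < t <= b -> cvg (g @ t^'-) &
      forall t, a < t <= b -> t \notin s -> g @ t^'- --> g t].
Proof.
split=> [[sab gc gl gr]|[sab gr gl gc]].
  have left t : a < t <= b -> t \notin s -> g @ t^'- --> g t.
    move=> /[dup] tab /andP[at_ tb] ts; have := gc t _ ts; rewrite (ltW at_) tb => /(_ isT) gt.
    by apply: cvg_trans gt => P /= gP; exact: (at_left_within_itv tab gP).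
  split=> // [t /[dup] tab /andP[at_ tb]|t tab].
    have [ts|ts] := boolP (t \in s); first exact: gr.
    have := gc t _ ts; rewrite at_ (ltW tb) => /(_ isT) gt.
    by apply: cvg_trans gt => P /= gP; exact: (at_right_within_itv tab gP).
  have [ts|ts] := boolP (t \in s); first exact: gl.
  by apply/cvg_ex; exists (g t); exact: left.
split=> //.
- move=> t /andP[at_ tb] ts; apply/cvgrPdist_lt => e e0.
  have R1 : \forall r \near t, t < r -> r <= b -> `|g t - g r| < e.
    have [tb'|bt] := ltP t b; last by near=> r => tr rb; have := lt_le_trans tr rb; lra.
    have := gr t; rewrite at_ tb' => /(_ isT)/cvgrPdist_lt/(_ e e0).
    by rewrite near_withinE; apply: filterS => r + tr _; exact.
  have L1 : \forall r \near t, r < t -> a <= r -> `|g t - g r| < e.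
    have [at'|ta] := ltP a t; last by near=> r => rt ar; have := le_lt_trans ar rt; lra.
    have := gc t _ ts; rewrite at' tb => /(_ isT)/cvgrPdist_lt/(_ e e0).
    by rewrite near_withinE; apply: filterS => r + rt _; exact.
  rewrite near_withinE; apply: filterS2 R1 L1 => r R1 L1 /=; rewrite in_itv/= => /andP[ar rb].
  by have [rt|tr|->] := ltgtP r t; [exact: L1|exact: R1|rewrite subrr normr0].
- by move=> c /sab/andP[ac cb]; apply: gl; rewrite ac ltW.
- by move=> c /sab/andP[ac cb]; apply: gr; rewrite cb ltW.
Unshelve. all: by end_near. Qed.

Lemma pcontinuous_at_mono (s s' : seq R) (g : R -> V) : pcontinuous_at a b s g ->
  {subset s <= s'} -> (forall c, c \in s' -> a < c < b) -> pcontinuous_at a b s' g.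
Proof.
move=> /pcontinuous_atP[_ gr gl gc] ss' s'ab; apply/pcontinuous_atP; split=> // t tab ts'.
by apply: gc => //; apply: contra ts'; exact: ss'.
Qed.

Lemma within_continuous_pcontinuous_at (g : R -> V) :
  {within `[a, b], continuous g} -> pcontinuous_at a b [::] g.
Proof.
by move=> /subspace_continuousP gc; split=> // t tab _; apply: gc; rewrite /= in_itv.
Qed.

Lemma pcontinuous_at_interior (s : seq R) (g : R -> V) t : pcontinuous_at a b s g ->
  a < t < b -> t \notin s -> {for t, continuous g}.
Proof.
move=> [_ gc _ _] /[dup] tab /andP[at_ tb] ts.
have := gc t _ ts; rewrite !ltW// => /(_ isT) gt.
rewrite within_interior// in gt.
near=> r; have : r \in `]a, b[%R by near: r; apply: near_in_itvoo; rewrite in_itv.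
by rewrite /= !in_itv/= => /andP[/ltW -> /ltW ->].
Unshelve. all: by end_near. Qed.

(** Near each point the right values are bounded by right continuity and the left values by the left
    limit; compactness of [[a, b]] joins these local bounds. *)
Lemma pcontinuous_at_bounded (s : seq R) (g : R -> V) : pcontinuous_at a b s g ->
  exists M, forall t, a <= t <= b -> `|g t| <= M.
Proof.
move=> /pcontinuous_atP[_ gr gl _].
have /compact_near_coveringP/near_covering_withinP := @segment_compact _ a b.
move=> /(_ R (pinfty_nbhs R) (fun M t => `|g t| <= M) _) cov.
suff nearM : \forall M \near pinfty_nbhs R, `[a, b] `<=` (fun t => `|g t| <= M).
  near (pinfty_nbhs R) => M; exists M => t tab.
  have gM : `[a, b] `<=` (fun t => `|g t| <= M) by near: M.
  by apply: gM; rewrite /= in_itv.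
apply: cov => t; rewrite /= in_itv/= => /andP[at_ tb].
have R1 : exists C, \forall r \near t, t < r -> r <= b -> `|g r| <= C.
  exists (`|g t| + 1).
  have [tb'|bt] := ltP t b; last by near=> r => tr rb; have := lt_le_trans tr rb; lra.
  have := gr t; rewrite at_ tb' => /(_ isT)/cvgrPdist_lt/(_ 1 ltr01).
  rewrite near_withinE; apply: filterS => r + tr _ => /(_ tr) gtr.
  by have := ler_normD (g t) (g r - g t); rewrite subrKC [`|g r - _|]distrC; lra.
have L1 : exists C, \forall r \near t, r < t -> a <= r -> `|g r| <= C.
  have [at'|ta] := ltP a t; last first.
    by exists 0; near=> r => rt ar; have := le_lt_trans ar rt; lra.
  have := gl t; rewrite at' tb => /(_ isT)/cvg_ex[l /cvgrPdist_lt/(_ 1 ltr01) H].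
  exists (`|l| + 1); move: H; rewrite near_withinE; apply: filterS => r + rt _ => /(_ rt) gtr.
  by have := ler_normD l (g r - l); rewrite subrKC [`|g r - _|]distrC; lra.
have [C1 RC1] := R1; have [C2 LC2] := L1.
exists ([set r | (t < r -> r <= b -> `|g r| <= C1) /\ (r < t -> a <= r -> `|g r| <= C2)],
  [set M | Num.max (Num.max C1 C2) `|g t| <= M]).
  by split; [apply: filterI|exact: nbhs_pinfty_ge (num_real _)].
move=> [r M] [/= [rC1 rC2]]; rewrite !ge_max => /andP[/andP[C1M C2M] gtM].
rewrite in_itv/= => /andP[ar rb].
have [rt|tr|->//] := ltgtP r t; [exact: le_trans (rC2 rt ar) C2M|exact: le_trans (rC1 tr rb) C1M].
Unshelve. all: by end_near. Qed.

Lemma pcontinuous_at_pw_bounded (s : seq R) (g : R -> V) : pcontinuous_at a b s g ->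
  pw_bounded_continuous a b s g.
Proof.
by move=> gs; split; [exact: pcontinuous_at_bounded gs|move=> t; exact: pcontinuous_at_interior].
Qed.

Lemma pcontinuous_at_cst (v : V) : pcontinuous_at a b [::] (fun=> v).
Proof.
apply: within_continuous_pcontinuous_at; apply: continuous_subspaceT => t.
exact: cvg_cst.
Qed.

Lemma pcontinuous_atD s (g g' : R -> V) : pcontinuous_at a b s g ->
  pcontinuous_at a b s g' -> pcontinuous_at a b s (fun t => g t + g' t).
Proof.
move=> /pcontinuous_atP[sab gr gl gc] /pcontinuous_atP[_ gr' gl' gc'].
apply/pcontinuous_atP; split=> // t tab.
- by apply: cvgD; [exact: gr|exact: gr'].
- by apply: is_cvgD; [exact: gl|exact: gl'].
- by move=> ts; apply: cvgD; [exact: gc|exact: gc'].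
Qed.

Lemma pcontinuous_atZ s (k : R -> R) (g : R -> V) : pcontinuous_at a b s k ->
  pcontinuous_at a b s g -> pcontinuous_at a b s (fun t => k t *: g t).
Proof.
move=> [sab kc kl kr] [_ gc gl gr]; split=> //.
- by move=> t tab ts; apply: cvgZ; [exact: kc|exact: gc].
- by move=> c cs; apply: is_cvgZ; [exact: kl|exact: gl].
- by move=> c cs; apply: cvgZ; [exact: kr|exact: gr].
Qed.

Lemma pcontinuous_at_sum s (I : Type) (r : seq I) (g : I -> R -> V) :
  (forall c, c \in s -> a < c < b) -> (forall i, pcontinuous_at a b s (g i)) ->
  pcontinuous_at a b s (fun t => \sum_(i <- r) g i t).
Proof.
move=> sab gs; elim: r => [|i r IH].
  rewrite (_ : (fun t => _) = fun=> 0); last by apply/funext => t; rewrite big_nil.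
  by apply: pcontinuous_at_mono (pcontinuous_at_cst 0) _ sab.
rewrite (_ : (fun t => _) = fun t => g i t + \sum_(i <- r) g i t).
  exact: pcontinuous_atD.
by apply/funext => t; rewrite big_cons.
Qed.

End piecewise_continuity.

Lemma pcontinuous_at_coord (R : realType) n (a b : R) s (g : R -> 'rV[R]_n) i :
  pcontinuous_at a b s g -> pcontinuous_at a b s (fun t => g t 0 i).
Proof.
move=> [sab gc gl gr]; split=> //.
- by move=> t tab ts; apply: cvg_coord; exact: gc.
- move=> c cs; have /cvg_ex[l gl'] := gl c cs; apply/cvg_ex; exists (l 0 i); exact: cvg_coord.
- by move=> c cs; apply: cvg_coord; exact: gr.
Qed.

Lemma pcontinuous_at_rV (R : realType) n (a b : R) s (g : R -> 'rV[R]_n) :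
  (forall c, c \in s -> a < c < b) ->
  (forall i, pcontinuous_at a b s (fun t => g t 0 i)) -> pcontinuous_at a b s g.
Proof.
move=> sab gi; split=> //.
- by move=> t tab ts; apply: cvg_rV => i; have [_ + _ _] := gi i; apply.
- move=> c cs; have /choice[l lP] : forall i, exists l : R, g t 0 i @[t --> c^'-] --> l.
    by move=> i; have [_ _ /(_ c cs)/cvg_ex + _] := gi i; exact.
  by apply/cvg_ex; exists (\row_i l i); apply: cvg_rV => i; rewrite mxE.
- by move=> c cs; apply: cvg_rV => i; have [_ _ _] := gi i; apply.
Qed.

Lemma pcontinuous_at_tube (R : realType) n q (W : normedModType R) (t0 t1 gam : R)
    (xs x : R -> 'rV[R]_n) (u : R -> 'rV[R]_q) (s : seq R)
    (h : R * 'rV[R]_n * 'rV[R]_q -> W) :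
  {within tube t0 t1 gam xs, continuous h} -> {within `[t0, t1], continuous x} ->
  (forall t, t0 <= t <= t1 -> `|x t - xs t| < gam) ->
  pcontinuous_at t0 t1 s u -> pcontinuous_at t0 t1 s (fun t => h (t, x t, u t)).
Proof.
move=> hc xc xg [sab uc ul ur].
(* One statement for any filter finer than the neighbourhoods of [t] within [[t0, t1]] serves the
   two-sided, left and right limits; [l] need not be the value [u t]. *)
have key t (F : set_system R) (l : 'rV[R]_q) : Filter F -> t0 <= t <= t1 ->
    F `=>` within `[t0, t1] (nbhs t) -> u @ F --> l ->
    h (r, x r, u r) @[r --> F] --> h (t, x t, l).
  move=> FF tI Ft ul'; apply: (cvg_within_comp _ hc).
  - by split=> //=; exact: xg.
  - have ct : r @[r --> F] --> t.
      by move=> P /= nP; apply: Ft; exact: cvg_within nP.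
    suff cx : x r @[r --> F] --> x t by exact: cvg_pair (cvg_pair ct cx) ul'.
    move/subspace_continuousP : xc => /(_ t); rewrite /= in_itv/= => /(_ tI) xt P /= nP.
    by apply: Ft; exact: xt.
  - have : F [set r | t0 <= r <= t1] by apply: Ft; rewrite /within/=; near=> r; rewrite in_itv.
    by apply: filterS => r rI; split=> //=; exact: xg.
split=> //.
- move=> t tI ts; apply: key => //; exact: uc.
- move=> c cs; have /andP[c0 c1] := sab c cs.
  have /cvg_ex[l ul'] := ul c cs; apply/cvg_ex; exists (h (c, x c, l)).
  apply: key => //; first by rewrite !ltW.
  by move=> P; apply: at_left_within_itv; rewrite // c0 ltW.
- move=> c cs; have /andP[c0 c1] := sab c cs; apply: key; first by rewrite !ltW.
    by move=> P; apply: at_right_within_itv; rewrite // c1 ltW.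
  exact: ur.
Unshelve. all: by end_near. Qed.

(** * Piecewise composed intervals and decompositions *)

Lemma pw_composed_interval0 (R : realType) : pw_composed_interval (@set0 R).
Proof. by exists [::] => //; apply/seteqP; split=> // t [i]. Qed.

Lemma pw_composed_intervalU (R : realType) (S S' : set R) :
  pw_composed_interval S -> pw_composed_interval S' -> pw_composed_interval (S `|` S').
Proof.
move=> [l lP ->] [l' l'P ->]; exists (l ++ l').
  by move=> i; rewrite mem_cat => /orP[/lP|/l'P].
apply/seteqP; split=> t /=.
  by move=> [[i il ti]|[i il ti]]; exists i => //; rewrite mem_cat il ?orbT.
by move=> [i]; rewrite mem_cat => /orP[il|il] ti; [left|right]; exists i.
Qed.

(** The bit [br] selects the right end: [true] gives [[c, d)] and [false] gives [[c, d]]. *)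
Lemma pw_composed_interval_itv (R : realType) (c d : R) (br : bool) : c < d ->
  pw_composed_interval [set` Interval (BLeft c) (BSide br d)].
Proof.
move=> cd; exists [:: Interval (BLeft c) (BSide br d)].
  by move=> i; rewrite inE => /eqP ->; exists (c, d) => //; case: br; [left|right].
by apply/seteqP; split=> t /= => [ti|[i]]; [eexists; [exact: mem_head|]|rewrite inE => /eqP ->].
Qed.

Lemma pw_composed_interval_ind (R : realType) (Q : set R -> Prop) : Q set0 ->
  (forall c d br S, c < d -> Q S -> Q ([set` Interval (BLeft c) (BSide br d)] `|` S)) ->
  forall S, pw_composed_interval S -> Q S.
Proof.
move=> Q0 QU S [l lP ->]; elim: l lP => [|i l IH] lP.
  by rewrite (_ : [set t | _] = set0)//; apply/seteqP; split=> // t [i].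
have -> : [set t | exists2 j, j \in i :: l & t \in j] =
    [set` i] `|` [set t | exists2 j, j \in l & t \in j].
  apply/seteqP; split=> t /=.
    by move=> [j]; rewrite inE => /predU1P[->|jl] tj; [left|right; exists j].
  by move=> [ti|[j jl tj]]; [exists i|exists j] => //; rewrite inE ?eqxx// jl orbT.
have [[c d] /= cd iE] := lP i (mem_head _ _).
have Ql : Q [set t | exists2 j, j \in l & t \in j].
  by apply: IH => j jl; apply: lP; rewrite inE jl orbT.
by case: iE => ->; exact: QU.
Qed.

(** Every piece contains its left end, so a point missed by a piece lies either strictly before it
    or past its right end. For membership the analogous claim fails at the right end of a closed
    piece. *)
Lemma pw_composed_interval_right (R : realType) (S : set R) (t : R) :
  pw_composed_interval S -> ~ S t -> \forall r \near t^'+, ~ S r.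
Proof.
move=> pS; elim/pw_composed_interval_ind : pS => {S} [|c d br S cd IH /not_orP[ti /IH St]].
  by move=> _; near=> r.
have H : \forall r \near t^'+, ~ [set` Interval (BLeft c) (BSide br d)] r.
  have [tc|ct] := ltP t c.
    near=> r; rewrite /= itv_boundlr/= bnd_simp => /andP[cr _].
    have : r < c by near: r; exact: nbhs_right_lt.
    by rewrite ltNge cr.
  near=> r; have tr : t < r by near: r; exact: nbhs_right_gt.
  move=> ri; apply: ti; move: ri; rewrite /= !itv_boundlr/= !bnd_simp ct/= => /andP[_].
  by apply: le_trans; rewrite bnd_simp ltW.
near=> r => -[]; [near: r; exact: H|near: r; exact: St].
Unshelve. all: by end_near. Qed.

Lemma pw_composed_interval_left (R : realType) (S : set R) (t : R) :
  pw_composed_interval S ->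
  (\forall r \near t^'-, S r) \/ (\forall r \near t^'-, ~ S r).
Proof.
move=> pS; elim/pw_composed_interval_ind : pS => {S} [|c d br S cd].
  by right; near=> r.
have H : (\forall r \near t^'-, [set` Interval (BLeft c) (BSide br d)] r) \/
    (\forall r \near t^'-, ~ [set` Interval (BLeft c) (BSide br d)] r).
  have [tc|ct] := leP t c.
    right; near=> r; have rt : r < t by near: r; exact: nbhs_left_lt.
    by rewrite /= itv_boundlr/= bnd_simp => /andP[cr _]; lra.
  have [td|dt] := leP t d.
    left; near=> r; have rt : r < t by near: r; exact: nbhs_left_lt.
    rewrite /= itv_boundlr/= bnd_simp; apply/andP; split.
      by near: r; exact: nbhs_left_ge.
    by case: (br); rewrite bnd_simp ?ltW// (lt_le_trans rt).
  right; near=> r; have rd : d < r by near: r; exact: nbhs_left_gt.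
  by rewrite /= itv_boundlr/= => /andP[_]; case: (br); rewrite bnd_simp; lra.
move=> [Sl|Sl]; first by left; apply: filterS Sl => r; right.
case: H => H; first by left; apply: filterS H => r; left.
by right; apply: filterS2 H Sl => r nr nS [].
Unshelve. all: by end_near. Qed.

Lemma pw_composed_interval_locally_constant (R : realType) (S : set R) :
  pw_composed_interval S -> exists P : seq R, forall t, t \notin P ->
  \forall r \near t, S r <-> S t.
Proof.
move=> pS; elim/pw_composed_interval_ind : pS => {S} [|c d br S cd [P SP]].
  by exists [::] => t _; near=> r.
exists [:: c, d & P] => t; rewrite !inE !negb_or => /and3P[tc td /SP St].
have H : \forall r \near t, [set` Interval (BLeft c) (BSide br d)] r <->
    [set` Interval (BLeft c) (BSide br d)] t.
  have key r : (c < r) = (c < t) -> (r < d) = (t < d) -> r != c -> r != d ->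
      [set` Interval (BLeft c) (BSide br d)] r <-> [set` Interval (BLeft c) (BSide br d)] t.
    move=> cr rd rc rd'; rewrite /= !itv_boundlr/=.
    suff -> : (BLeft c <= BLeft r)%O && (BRight r <= BSide br d)%O =
        ((BLeft c <= BLeft t)%O && (BRight t <= BSide br d)%O) by [].
    rewrite !bnd_simp !(le_eqVlt c) ![c == _]eq_sym (negbTE rc) (negbTE tc) cr.
    by case: (br); rewrite !bnd_simp ?rd// !le_eqVlt (negbTE rd') (negbTE td) rd.
  have near_neq e : t != e -> \forall r \near t, r != e.
    have [te|et|//] := ltgtP t e => _.
      by apply: filterS (lt_nbhsl te) => r re; rewrite lt_eqF.
    by apply: filterS (lt_nbhsr et) => r er; rewrite gt_eqF.
  have near_c : \forall r \near t, (c < r) = (c < t).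
    have [ct|ct|ct] := ltgtP c t; last by rewrite ct eqxx in tc.
      by apply: filterS (lt_nbhsr ct) => r ->.
    by apply: filterS (lt_le_nbhsl ct) => r rc; apply/negbTE; rewrite -leNgt.
  have near_d : \forall r \near t, (r < d) = (t < d).
    have [td'|dt|dt] := ltgtP t d; last by rewrite dt eqxx in td.
      by apply: filterS (lt_nbhsl td') => r ->.
    by apply: filterS (lt_le_nbhsr dt) => r dr; apply/negbTE; rewrite -leNgt.
  by near=> r; apply: key; near: r; [exact: near_c|exact: near_d|exact: near_neq|exact: near_neq].
apply: filterS2 H St => r [ir ri] [Sr rS].
by split=> -[h|h]; [left; exact: ir|right; exact: Sr|left; exact: ri|right; exact: rS].
Unshelve. all: by end_near. Qed.

(** A piece containing the largest point [t] must end there, since otherwise it would contain points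
    beyond [t]; having positive length, it fills a left neighbourhood. This gives continuity of the
    indicators at the end [t1]. *)
Lemma pw_composed_interval_top (R : realType) (S : set R) (t : R) :
  pw_composed_interval S -> (forall r, S r -> r <= t) -> S t -> \forall r \near t^'-, S r.
Proof.
move=> pS; elim/pw_composed_interval_ind : pS => {S} [//|c d br S cd IH leS [ti|St]]; last first.
  have : \forall r \near t^'-, S r by apply: IH => // r Sr; apply: leS; right.
  by apply: filterS => r; right.
have td : t = d.
  apply/eqP; rewrite eq_le; move: (ti); rewrite /= itv_boundlr/= bnd_simp => /andP[ct td].
  have -> /= : t <= d by case: (br) td; rewrite bnd_simp// => /ltW.
  rewrite leNgt; apply/negP => td'.
  have := leS ((t + d) / 2); have : t < (t + d) / 2 by lra.
  move=> /lt_geF -> /(_ _)/notF; apply; left; rewrite /= itv_boundlr/= bnd_simp.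
  apply/andP; split; first lra.
  by case: (br); rewrite bnd_simp; lra.
near=> r; left; rewrite /= itv_boundlr/= bnd_simp; apply/andP; split.
  by near: r; apply: nbhs_left_ge; rewrite td.
have rt : r < t by near: r; exact: nbhs_left_lt.
by case: (br); rewrite bnd_simp -td// ltW.
Unshelve. all: by end_near. Qed.

(** When [tau] avoids the ends of the pieces, a short window misses a given piece or lies inside it
    and leaves two pieces of positive length. *)
Lemma pw_composed_interval_needle (R : realType) (S : set R) :
  pw_composed_interval S -> exists P : seq R, forall tau, tau \notin P ->
  exists2 del : R, 0 < del & forall lam, 0 < lam < del ->
    pw_composed_interval (S `\` `[tau, tau + lam[).
Proof.
move=> pS; elim/pw_composed_interval_ind : pS => {S} [|c d br S cd [P SP]].
  exists [::] => tau _; exists 1 => // lam _; rewrite set0D.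
  exact: pw_composed_interval0.
exists [:: c, d & P] => tau; rewrite !inE !negb_or => /and3P[tc td /SP[del del0 delP]].
suff [del' del'0 del'P] : exists2 del : R, 0 < del & forall lam, 0 < lam < del ->
    pw_composed_interval ([set` Interval (BLeft c) (BSide br d)] `\` `[tau, tau + lam[).
  exists (Num.min del del'); first by rewrite lt_min del0.
  move=> lam; rewrite lt_min => /andP[lam0 /andP[l1 l2]].
  by rewrite setDUl; apply: pw_composed_intervalU; [apply: del'P|apply: delP]; rewrite lam0.
have disj lam : (tau + lam <= c) || (d < tau) ->
    pw_composed_interval ([set` Interval (BLeft c) (BSide br d)] `\` `[tau, tau + lam[).
  move=> cdt; rewrite (_ : _ `\` _ = [set` Interval (BLeft c) (BSide br d)]).
    exact: pw_composed_interval_itv.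
  apply/seteqP; split=> [t []//|t ti]; split=> //.
  rewrite /= in_itv/= => /andP[taut ttau]; move: ti.
  rewrite /= itv_boundlr/= bnd_simp => /andP[ct tdd].
  have {}tdd : t <= d by case: (br) tdd; rewrite bnd_simp// => /ltW.
  by case/orP: cdt; lra.
have [tauc|ctau|ctau] := ltgtP tau c; last by rewrite ctau eqxx in tc.
  exists (c - tau); first by rewrite subr_gt0.
  by move=> lam /andP[_ lamc]; apply: disj; apply/orP; left; lra.
have [taud|dtau|dtau] := ltgtP tau d; last by rewrite dtau eqxx in td.
  exists (d - tau); first by rewrite subr_gt0.
  move=> lam /andP[lam0 lamd].
  have -> : [set` Interval (BLeft c) (BSide br d)] `\` `[tau, tau + lam[ =
     `[c, tau[ `|` [set` Interval (BLeft (tau + lam)) (BSide br d)].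
    apply/seteqP; split=> t; rewrite /= !itv_boundlr/= !bnd_simp.
      move=> [/andP[ct tdd]] /negP; rewrite negb_and -ltNge -leNgt => /orP[ttau|ttau].
        by left; rewrite ct.
      by right; rewrite ttau.
    move=> [/andP[ct ttau]|/andP[ttau tdd]].
      split; last by rewrite leNgt ttau.
      by rewrite ct; case: (br); rewrite bnd_simp; lra.
    split; last by rewrite [t < _]ltNge ttau andbF.
    by rewrite tdd andbT; lra.
  apply: pw_composed_intervalU; first exact: (pw_composed_interval_itv true).
  by apply: pw_composed_interval_itv; lra.
by exists 1 => // lam _; apply: disj; rewrite dtau orbT.
Qed.

Lemma indic_cvg (R : realType) (F : set_system R) (FF : Filter F) (S : set R) (l : R) :
  (\forall r \near F, S r <-> l = 1) -> l = 0 \/ l = 1 ->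
  (\1_S : R -> R) @ F --> l.
Proof.
move=> Sl l01; apply: cvg_near_cst; apply: filterS Sl => r Sr.
rewrite indicE; case: l01 Sr => -> Sr; last by rewrite mem_set//; exact: Sr.2.
rewrite memNset// => /Sr.1/esym/eqP; by rewrite oner_eq0.
Qed.

(* Right continuity: a component that misses [t] misses a right neighbourhood of [t],
   so the component containing [t] fills one. *)
Lemma decomposition_indicator (R : realType) k (t0 t1 : R) (A : 'I_k -> set R) :
  t0 < t1 -> decomposition `[t0, t1] A ->
  exists P : seq R, forall s, pcontinuous_at t0 t1 P (\1_(A s) : R -> R).
Proof.
move=> t01 [pA dA cA].
have coverA t : t0 <= t <= t1 -> exists s, A s t.
  move=> tI; have : (\bigcup_s A s) t by rewrite cA /= in_itv.
  by move=> [s _ ?]; exists s.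
have subA s t : A s t -> t0 <= t <= t1.
  by move=> ?; have : (\bigcup_s A s) t by [exists s]; rewrite cA /= in_itv.
have uniqA s s' t : A s t -> A s' t -> s = s'.
  move=> st s't; apply/eqP/negPn/negP => /dA; apply/eqP/set0P; by exists t.
have /choice[P PP] := fun s => pw_composed_interval_locally_constant (pA s).
(* Exceptional points must be interior, so the ends [t0] and [t1] are filtered out and continuity
   there has to be proved. *)
pose Pi := [seq c <- flatten [seq P s | s <- enum 'I_k] | t0 < c < t1].
have PiP t s : t0 < t < t1 -> t \notin Pi -> t \notin P s.
  move=> tI; apply: contra => tP; rewrite mem_filter tI; apply/flattenP; exists (P s) => //.
  by apply/mapP; exists s; rewrite ?mem_enum.
have one_zero s t : (\1_(A s) t : R) = 0 \/ (\1_(A s) t : R) = 1.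
  by rewrite indicE; case: (_ \in _); [right|left].
have indicP s t : A s t <-> (\1_(A s) t : R) = 1.
  rewrite indicE; have [st|st] := pselect (A s t); first by rewrite mem_set.
  by rewrite memNset//; split=> // /esym/eqP; rewrite oner_eq0.
exists Pi => s; apply/pcontinuous_atP => //; split.
- by move=> c; rewrite mem_filter => /andP[].
- move=> t /andP[t0t tt1]; apply: indic_cvg => //.
  have tI : t0 <= t <= t1 by rewrite t0t ltW.
  have [s0 As0] := coverA t tI.
  have others : \forall r \near t^'+, forall s', s' != s0 -> ~ A s' r.
    apply: filter_forall => s'; have [->|s's0] := eqVneq s' s0; first by near=> r.
    apply: filterS (pw_composed_interval_right (pA s') _) => [r + _ //|As'].
    by move: s's0; rewrite (uniqA _ _ _ As' As0) eqxx.
  have inI : \forall r \near t^'+, t0 <= r <= t1.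
    near=> r; apply/andP; split; last by near: r; exact: nbhs_right_le.
    by rewrite (le_trans t0t)//; near: r; exact: nbhs_right_ge.
  apply: filterS2 others inI => r others rI; rewrite -indicP.
  have [s1 As1] := coverA r rI.
  have s10 : s1 = s0 by apply/eqP/negPn/negP => /others; apply.
  rewrite {}s10 in As1.
  by split=> [Ar|At]; [rewrite (uniqA _ _ _ Ar As1)|rewrite (uniqA _ _ _ At As0)].
- move=> t tI; have [Sl|Sl] := pw_composed_interval_left t (pA s); apply/cvg_ex.
    by exists 1; apply: indic_cvg; last by [right]; apply: filterS Sl.
  exists 0; apply: indic_cvg; last by left.
  by apply: filterS Sl => r nS; split=> // /esym/eqP; rewrite oner_eq0.
move=> t /andP[t0t]; rewrite le_eqVlt => /predU1P[->|tt1] tPi; last first.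
  apply: cvg_at_left_filter; apply: indic_cvg => //.
  have := PP s t (PiP t s _ tPi); rewrite t0t tt1 => /(_ isT).
  by apply: filterS => r [Sr Sr']; rewrite -indicP.
(* At [t1] local constancy is of no help, since [t1] may be an end of a piece. The component that
   contains [t1] fills a left neighbourhood of it, and disjointness settles the others. *)
have top s' : A s' t1 -> \forall r \near t1^'-, A s' r.
  by apply: pw_composed_interval_top => // r /subA/andP[].
have t1I : t0 <= t1 <= t1 by rewrite ltW/=.
have [s0 As0] := coverA t1 t1I.
apply: indic_cvg => //; apply: filterS (top s0 As0) => r Ar; rewrite -indicP.
by split=> [Ar'|At]; [rewrite (uniqA _ _ _ Ar' Ar)|rewrite (uniqA _ _ _ At As0)].
Unshelve. all: by end_near. Qed.

(** The window is half-open so that adding it to one component and removing it from the others again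
    leaves pieces [[a, b)] or [[a, b]]. *)
Definition needle (R : realType) k (A : 'I_k -> set R) (s : 'I_k) (tau lam : R)
    (s' : 'I_k) : set R :=
  if s' == s then A s `|` `[tau, tau + lam[ else A s' `\` `[tau, tau + lam[.

Lemma decomposition_needle (R : realType) k (t0 t1 : R) (A : 'I_k -> set R) :
  decomposition `[t0, t1] A -> exists P : seq R, forall tau, t0 < tau < t1 ->
  tau \notin P -> exists2 del : R, 0 < del & forall lam s, 0 < lam < del ->
    decomposition `[t0, t1] (needle A s tau lam).
Proof.
move=> [pA dA cA].
have /choice[P PP] := fun s => pw_composed_interval_needle (pA s).
exists (flatten [seq P s | s <- enum 'I_k]) => tau /andP[t0tau taut1] tauP.
have /choice[del delP] : forall s, exists del : R, 0 < del /\ forall lam, 0 < lam < del ->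
    pw_composed_interval (A s `\` `[tau, tau + lam[).
  move=> s; have [|del del0 delP] := PP s tau; last by exists del.
  apply: contra tauP => tauPs; apply/flattenP; exists (P s) => //.
  by apply/mapP; exists s; rewrite ?mem_enum.
(* The starting value [t1 - tau] of the minimum keeps the window inside [[t0, t1]]. *)
exists (\big[Num.min/(t1 - tau)]_s del s).
  by apply: lt_bigmin => [|s _]; [rewrite subr_gt0|have [] := delP s].
move=> lam s /andP[lam0 lamd].
have lam_del s' : lam < del s' by apply: lt_le_trans lamd _; exact: bigmin_le_cond.
have lam_t1 : tau + lam < t1.
  by rewrite addrC -ltrBrDr; apply: lt_le_trans lamd _; exact: bigmin_le_id.
have sN : `[tau, tau + lam[ `<=` `[t0, t1].
  by move=> t; rewrite /= !in_itv/= => /andP[taut ttau]; apply/andP; split; lra.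
split.
- move=> s'; rewrite /needle; case: ifPn => _; last by apply: (delP s').2; rewrite lam0 lam_del.
  apply: pw_composed_intervalU => //.
  by apply: (pw_composed_interval_itv true); rewrite ltrDl.
- move=> s1 s2 s12; rewrite /needle; case: ifPn => [/eqP s1s|s1s]; case: ifPn => [/eqP s2s|s2s].
  + by rewrite s1s s2s eqxx in s12.
  + apply/seteqP; split=> // t [[At|Nt] [At' Nt']] //.
    have : (A s `&` A s2) t by [].
    by rewrite dA// eq_sym.
  + apply/seteqP; split=> // t [[At' Nt'] [At|Nt]] //.
    by have : (A s1 `&` A s) t by []; rewrite dA.
  + apply/seteqP; split=> // t [[At1 _] [At2 _]].
    by have : (A s1 `&` A s2) t by []; rewrite dA.
- apply/seteqP; split=> t.
    move=> [s' _]; rewrite /needle; case: ifPn => _ => [[At|/sN//]|[At _]];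
      by rewrite -cA; eexists; last exact: At.
  rewrite -cA => -[s' _ At].
  have [Nt|Nt] := pselect (`[tau, tau + lam[%classic t).
    by exists s => //; rewrite /needle eqxx; right.
  exists s' => //; rewrite /needle; case: ifPn => [/eqP <-|_]; last by [].
  by left.
Qed.

(** * Switching on a window *)

Lemma pcontinuous_atM (R : realType) (a b : R) s (g g' : R -> R) :
  pcontinuous_at a b s g -> pcontinuous_at a b s g' ->
  pcontinuous_at a b s (fun t => g t * g' t).
Proof. exact: pcontinuous_atZ. Qed.

Lemma pcontinuous_atN (R : realType) (V : normedModType R) (a b : R) s (g : R -> V) :
  pcontinuous_at a b s g -> pcontinuous_at a b s (fun t => - g t).
Proof.
move=> [sab gc gl gr]; split=> //.
- by move=> t tab ts; apply: cvgN; exact: gc.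
- by move=> c cs; apply: is_cvgN; exact: gl.
- by move=> c cs; apply: cvgN; exact: gr.
Qed.

Lemma pcontinuous_atB (R : realType) (V : normedModType R) (a b : R) s (g g' : R -> V) :
  pcontinuous_at a b s g -> pcontinuous_at a b s g' ->
  pcontinuous_at a b s (fun t => g t - g' t).
Proof. by move=> gs g's; apply: pcontinuous_atD => //; exact: pcontinuous_atN. Qed.

Lemma pcontinuous_at_indic_itv (R : realType) (a b c d : R) : a < c -> c < d -> d < b ->
  pcontinuous_at a b [:: c; d] (\1_(`[c, d[%classic) : R -> R).
Proof.
move=> ac cd db.
have pN : pw_composed_interval `[c, d[%classic by exact: (pw_composed_interval_itv true).
have NE t : `[c, d[%classic t <-> c <= t < d by rewrite /= in_itv.
have one_zero t : (\1_(`[c, d[%classic) t : R) = 0 \/ (\1_(`[c, d[%classic) t : R) = 1.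
  by rewrite indicE; case: (_ \in _); [right|left].
have indicP t : `[c, d[%classic t <-> (\1_(`[c, d[%classic) t : R) = 1.
  rewrite indicE; have [st|st] := pselect (`[c, d[%classic t); first by rewrite mem_set.
  by rewrite memNset//; split=> // /esym/eqP; rewrite oner_eq0.
apply/pcontinuous_atP => //; split.
- by move=> e; rewrite !inE => /orP[|] /eqP ->; apply/andP; split; lra.
- move=> t /andP[at_ tb]; apply: indic_cvg => //.
  have [Nt|Nt] := pselect (`[c, d[%classic t); last first.
    apply: filterS (pw_composed_interval_right pN Nt) => r Nr.
    by rewrite -indicP.
  move: (Nt) => /NE/andP[ct td]; near=> r; rewrite -indicP; split=> // _.
  apply/NE/andP; split; first by rewrite (le_trans ct)//; near: r; exact: nbhs_right_ge.
  by near: r; exact: nbhs_right_lt.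
- move=> t tI; have [Sl|Sl] := pw_composed_interval_left t pN; apply/cvg_ex.
    by exists 1; apply: indic_cvg; last by [right]; apply: filterS Sl.
  exists 0; apply: indic_cvg; last by left.
  by apply: filterS Sl => r nS; split=> // /esym/eqP; rewrite oner_eq0.
move=> t _; rewrite !inE negb_or => /andP[tc td].
apply: cvg_at_left_filter; apply: indic_cvg => //.
have [t1|t1|t1] := ltgtP t c; last by rewrite t1 eqxx in tc.
  apply: filterS (lt_nbhsl t1) => r rc; rewrite -indicP.
  by split=> /NE/andP[]; lra.
have [t2|t2|t2] := ltgtP t d; last by rewrite t2 eqxx in td.
  apply: filterS2 (lt_nbhsr t1) (lt_nbhsl t2) => r cr rd; rewrite -indicP.
  by split=> _; apply/NE/andP; split; rewrite // ltW.
apply: filterS (lt_nbhsr t2) => r dr; rewrite -indicP.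
by split=> /NE/andP[]; lra.
Unshelve. all: by end_near. Qed.

Lemma pcontinuous_at_window (R : realType) (V : normedModType R) (a b c d : R) s
    (g g' : R -> V) : a < c -> c < d -> d < b ->
  pcontinuous_at a b s g -> pcontinuous_at a b s g' ->
  pcontinuous_at a b [:: c, d & s] (fun t => if c <= t < d then g t else g' t).
Proof.
move=> ac cd db gs g's.
have sab : forall e, e \in [:: c, d & s] -> a < e < b.
  move=> e; rewrite !inE => /or3P[/eqP ->|/eqP ->|es]; try (apply/andP; split; lra).
  by have [/(_ e es)] := gs.
have ext (V' : normedModType R) (h : R -> V') :
    pcontinuous_at a b s h -> pcontinuous_at a b [:: c, d & s] h.
  by move=> /pcontinuous_at_mono; apply=> // e es; rewrite !inE es !orbT.
have iN : pcontinuous_at a b [:: c, d & s] (\1_(`[c, d[%classic) : R -> R).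
  apply: pcontinuous_at_mono (pcontinuous_at_indic_itv ac cd db) _ sab => // e.
  by rewrite !inE => /orP[|] ->; rewrite ?orbT.
(* The switch is rewritten as the indicator of the window times [g - g'], plus [g'], so the sum and
   product rules apply. *)
rewrite (_ : (fun t => _) = fun t => (\1_(`[c, d[%classic) t : R) *: (g t - g' t) + g' t).
  apply: pcontinuous_atD => //; last exact: ext.
  apply: pcontinuous_atZ => //; apply: pcontinuous_atB => //; exact: ext.
apply/funext => t; rewrite indicE; case: ifPn => tcd.
  by rewrite mem_set /= ?in_itv// scale1r subrK.
by rewrite memNset /= ?in_itv/= ?scale0r ?add0r//; exact/negP.
Qed.

Lemma rV_window_increment_le (R : realType) n (E : seq R) (f df : R -> 'rV[R]_n)
    (a b c d M : R) : a <= c <= d -> d <= b -> 0 <= M ->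
  {within `[a, b], continuous f} ->
  (forall t, a < t < b -> t \notin E -> is_derive t 1 f (df t)) ->
  (forall t, a < t < b -> t \notin E -> `|df t| <= if c < t < d then M else 0) ->
  forall t, a <= t <= b -> `|f t - f a| <= M * (d - c).
Proof.
move=> /andP[ac cd] db M0 cf fd dfM t /andP[at_ tb].
(* Since the estimate is wanted at every [t], the window is clipped at [t]; clipping can only
   shorten it. *)
pose c' := Num.min c t; pose d' := Num.min d t.
have cd' : a <= c' <= d'.
  by rewrite /c' /d' !le_min !ge_min ac at_ cd lexx/= orbT.
have d't : d' <= t by rewrite ge_min lexx orbT.
have d'c' : d' - c' <= d - c.
  by rewrite /c' /d'; case: (leP c t); case: (leP d t); lra.
have sub : {within `[a, t], continuous f}.
  by apply: continuous_subspaceW cf; apply: subset_itvl; rewrite bnd_simp.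
have win r : a < r < t -> (c' < r < d') = (c < r < d).
  by move=> /andP[ar rt]; rewrite lt_min rt andbT gt_min [t < r]ltNge (ltW rt) orbF.
have lt_b r : a < r < t -> a < r < b by move=> /andP[-> rt]; rewrite (lt_le_trans rt).
apply: rV_norm_le => [|i]; first by rewrite mulr_ge0// subr_ge0.
(* The scalar window estimate is one-sided; the signs [e = 1] and [e = -1] together give the
   absolute value. *)
have bound (e : R) : `|e| = 1 -> e * f t 0 i - e * f a 0 i <= M * (d - c).
  move=> e1; apply: (@le_trans _ _ (M * (d' - c') + 0 * (t - a))); last first.
    by rewrite mul0r addr0 ler_wpM2l.
  have dfe r : a < r < t -> r \notin E -> e * df r 0 i <= `|df r|.
    move=> rI rE; rewrite (le_trans (ler_norm _))// normrM e1 mul1r; exact: rV_coord_le.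
  apply: (@window_increment_le _ E (fun s => e * f s 0 i) (fun s => e * df s 0 i)) => //.
  - move=> s; apply: continuousM; first exact: cvg_cst.
    by have h := within_continuous_coord (i := i) sub (x := s); exact: h.
  - move=> r rI rE; have h := (is_derive_rV f (df r) r).1 (fd r (lt_b r rI) rE) i.
    exact: (is_deriveZ e h).
  - move=> r /andP[cr rd] rE; have rI : a < r < t.
      by case/andP: cd' => ac' _; rewrite (le_lt_trans ac')//= (lt_le_trans rd).
    apply: le_trans (dfe r rI rE) _; have := dfM r (lt_b r rI) rE.
    by rewrite -win// cr rd.
  - move=> r rI rE nw; apply: le_trans (dfe r rI rE) _.
    by have := dfM r (lt_b r rI) rE; rewrite -win// (negbTE nw).
rewrite !mxE ler_norml; apply/andP; split.
  by have := bound (-1); rewrite normrN1 => /(_ erefl); lra.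
by have := bound 1; rewrite normr1 => /(_ erefl); lra.
Qed.

(** * The Pontryagin function *)

Lemma within_eq_continuous (T S : topologicalType) (A : set T) (f g : T -> S) :
  (forall x, A x -> f x = g x) -> {within A, continuous f} -> {within A, continuous g}.
Proof.
by move=> fg; apply: subspace_eq_continuous => x /set_mem; exact: fg.
Qed.

Lemma within_continuous_sum (R : realType) (T : topologicalType) (V : normedModType R)
    (A : set T) (I : Type) (r : seq I) (g : I -> T -> V) :
  (forall i, {within A, continuous (g i)}) ->
  {within A, continuous (fun t => \sum_(i <- r) g i t)}.
Proof.
move=> gc; elim: r => [|i r IH].
  rewrite (_ : (fun t => _) = fun=> 0); last by apply/funext => t; rewrite big_nil.
  by apply: continuous_subspaceT => t; exact: cvg_cst.
rewrite (_ : (fun t => _) = fun t => g i t + \sum_(i <- r) g i t).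
  exact: within_continuousD.
by apply/funext => t; rewrite big_cons.
Qed.

(** * Calculus of the inner product *)

Section inner_product.
Context (R : realType) (n : nat).
Implicit Types p q : 'rV[R]_n.

Lemma innerDr p q q' : inner p (q + q') = inner p q + inner p q'.
Proof. by rewrite /inner -big_split; apply: eq_bigr => i _; rewrite mxE mulrDr. Qed.

Lemma innerZr (c : R) p q : inner p (c *: q) = c * inner p q.
Proof. by rewrite /inner mulr_sumr; apply: eq_bigr => i _; rewrite mxE mulrCA. Qed.

Lemma innerNr p q : inner p (- q) = - inner p q.
Proof. by rewrite -scaleN1r innerZr mulN1r. Qed.

Lemma innerBr p q q' : inner p (q - q') = inner p q - inner p q'.
Proof. by rewrite innerDr innerNr. Qed.

Lemma inner0r p : inner p 0 = 0.
Proof. by rewrite -(scale0r 0) innerZr mul0r. Qed.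

Lemma innerC p q : inner p q = inner q p.
Proof. by apply: eq_bigr => i _; rewrite mulrC. Qed.

Lemma inner_sumr p (I : Type) (r : seq I) (q : I -> 'rV[R]_n) :
  inner p (\sum_(i <- r) q i) = \sum_(i <- r) inner p (q i).
Proof. by elim/big_rec2 : _ => [|i x y _ <-]; [exact: inner0r|exact: innerDr]. Qed.

Lemma inner_norm_le p q : `|inner p q| <= n%:R * `|p| * `|q|.
Proof.
rewrite (le_trans (ler_norm_sum _ _ _))//.
apply: (@le_trans _ _ (\sum_(i < n) `|p| * `|q|)).
  by apply: ler_sum => i _; rewrite normrM ler_pM//; exact: rV_coord_le.
by rewrite sumr_const card_ord -mulrA mulr_natl.
Qed.

Lemma inner_is_derive (p q : R -> 'rV[R]_n) (dp dq : 'rV[R]_n) (t : R) :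
  is_derive t 1 p dp -> is_derive t 1 q dq ->
  is_derive t 1 (fun s => inner (p s) (q s)) (inner dp (q t) + inner (p t) dq).
Proof.
move=> /is_derive_rV pd /is_derive_rV qd.
have h (i : 'I_n) : is_derive t 1 (fun s => p s 0 i * q s 0 i)
    (p t 0 i *: dq 0 i + q t 0 i *: dp 0 i).
  by have := pd i; have := qd i => hq hp; exact: is_deriveM.
have := is_derive_sum h; rewrite (_ : \sum_(i < n) _ = fun s => inner (p s) (q s)).
  move=> h'; apply: (is_derive_eq h'); rewrite /inner -big_split; apply: eq_bigr => i _ /=.
  by rewrite addrC; congr (_ + _); exact: mulrC.
by apply/funext => s; rewrite fct_sumE.
Qed.

Lemma within_continuous_inner (T : topologicalType) (A : set T) (p q : T -> 'rV[R]_n) :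
  {within A, continuous p} -> {within A, continuous q} ->
  {within A, continuous (fun t => inner (p t) (q t))}.
Proof.
move=> pc qc; apply: within_continuous_sum => i t; apply: continuousM.
  by have h := within_continuous_coord (i := i) pc (x := t); exact: h.
by have h := within_continuous_coord (i := i) qc (x := t); exact: h.
Qed.

Lemma pcontinuous_at_inner (a b : R) s (p q : R -> 'rV[R]_n) :
  pcontinuous_at a b s p -> pcontinuous_at a b s q ->
  pcontinuous_at a b s (fun t => inner (p t) (q t)).
Proof.
move=> ps qs; apply: pcontinuous_at_sum => //; first by case: ps.
by move=> i; apply: pcontinuous_atM; exact: pcontinuous_at_coord.
Qed.

End inner_product.

Section differentials.
Context (R : realType) (n : nat).

Lemma differentiable_rV_coord l (g : 'rV[R]_n -> 'rV[R]_l) (z : 'rV[R]_n) i :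
  differentiable g z -> differentiable (fun y => g y 0 i) z.
Proof.
move=> dg; apply: (@differentiable_comp _ _ _ _ g (fun w : 'rV[R]_l => w 0 i)) => //.
exact: differentiable_coord.
Qed.

Lemma diff_rV_coord l (g : 'rV[R]_n -> 'rV[R]_l) (z v : 'rV[R]_n) i :
  differentiable g z -> 'd (fun y => g y 0 i) z v = 'd g z v 0 i.
Proof.
move=> dg; rewrite -deriveE; last exact: differentiable_rV_coord.
by rewrite -deriveE// derive_mx ?mxE//; exact: diff_derivable.
Qed.

Lemma inner_sub_diff l (p : 'rV[R]_l) (g : 'rV[R]_n -> 'rV[R]_l) (h : 'rV[R]_n -> R)
    (z : 'rV[R]_n) : differentiable g z -> differentiable h z ->
  differentiable (fun y => inner p (g y) - h y) z /\
  forall v, 'd (fun y => inner p (g y) - h y) z v = inner p ('d g z v) - 'd h z v.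
Proof.
move=> dg dh.
have E : (fun y => inner p (g y) - h y) = (\sum_i (p 0 i \*: (fun y => g y 0 i))) - h.
  by apply/funext => y; rewrite [RHS]/= /inner fct_sumE.
have dgi i : differentiable (fun y => g y 0 i) z by exact: differentiable_rV_coord.
have dZ i : differentiable (p 0 i \*: (fun y => g y 0 i)) z by exact: differentiableZ.
have dS : differentiable (\sum_i (p 0 i \*: (fun y => g y 0 i))) z.
  exact: differentiable_sum.
rewrite E; split; first exact: differentiableB.
move=> v; rewrite -deriveE; last exact: differentiableB.
rewrite deriveB; [|exact: diff_derivable|exact: diff_derivable].
rewrite (deriveE _ dh) derive_sum; last by move=> i; exact: diff_derivable.
congr (_ - _); apply: eq_bigr => i _; rewrite deriveZ; last exact: diff_derivable.
by rewrite deriveE// diff_rV_coord.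
Qed.

End differentials.

Lemma continuous_C1x_coord (R : realType) n q l (D : set (R * 'rV[R]_n * 'rV[R]_q))
    (h : R -> 'rV[R]_n -> 'rV[R]_q -> 'rV[R]_l) i :
  continuous_C1x D h -> continuous_C1x D (fun t y u => h t y u 0 i).
Proof.
move=> [hc hd hdc]; split.
- by have H := within_continuous_coord (i := i) hc; exact: H.
- by move=> z Dz; apply: differentiable_rV_coord; exact: hd.
- move=> v.
  pose g1 (z : R * 'rV[R]_n * 'rV[R]_q) : R :=
    ('d (fun y : 'rV[R]_n => h z.1.1 y z.2) (z.1.2) v) 0 i.
  pose g2 (z : R * 'rV[R]_n * 'rV[R]_q) : R :=
    'd (fun y : 'rV[R]_n => h z.1.1 y z.2 0 i) (z.1.2) v.
  suff : {within D, continuous g2} by exact.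
  apply: (@within_eq_continuous _ _ D g1).
    by move=> z Dz; rewrite /g1 /g2 diff_rV_coord//; exact: hd.
  by have H := within_continuous_coord (i := i) (hdc v); exact: H.
Qed.

Section pontryagin_C1.
Context (R : realType) (n q : nat) (t0 t1 gam : R) (xs p : R -> 'rV[R]_n).
Variables (f : R -> 'rV[R]_n -> 'rV[R]_q -> R) (phi : R -> 'rV[R]_n -> 'rV[R]_q -> 'rV[R]_n).
Let D := @tube R n q t0 t1 gam xs.
Hypotheses (p_cont : {within `[t0, t1], continuous p}).
Hypotheses (f_C1 : continuous_C1x D f) (phi_C1 : continuous_C1x D phi).

Lemma hamiltonian_diff t y u v : D (t, y, u) ->
  'd (fun y => inner (p t) (phi t y u) - f t y u) y v =
  inner (p t) ('d (fun y => phi t y u) y v) - 'd (fun y => f t y u) y v.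
Proof.
move=> Dz; have [_ /(_ _ Dz) fd _] := f_C1; have [_ /(_ _ Dz) phid _] := phi_C1.
by have [_ ->] := inner_sub_diff (p t) phid fd.
Qed.

(** Once [p t] is inserted, the Hamiltonian has the same regularity as the data, so the tube
    estimates apply to it directly. *)
Lemma continuous_C1x_hamiltonian :
  continuous_C1x D (fun t y u => inner (p t) (phi t y u) - f t y u).
Proof.
have [fc fd fdc] := f_C1; have [phic phid phidc] := phi_C1.
have pc : {within D, continuous (fun z => p z.1.1)}.
  apply: (@within_continuous_comp _ _ _ D `[t0, t1]%classic
    (fun z : R * 'rV[R]_n * 'rV[R]_q => z.1.1) p) => //.
    apply: continuous_subspaceT => z.
    by apply: (@cvg_comp _ _ _ fst fst); [exact: cvg_fst|exact: cvg_fst].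
  by move=> z [zI _]; rewrite /= in_itv.
split.
- by apply: within_continuousB => //; exact: within_continuous_inner.
- by move=> z Dz; have [] := inner_sub_diff (p z.1.1) (phid z Dz) (fd z Dz).
- move=> v.
  pose g1 (z : R * 'rV[R]_n * 'rV[R]_q) : R :=
    inner (p z.1.1) ('d (fun y : 'rV[R]_n => phi z.1.1 y z.2) (z.1.2) v) -
    'd (fun y : 'rV[R]_n => f z.1.1 y z.2) (z.1.2) v.
  pose g2 (z : R * 'rV[R]_n * 'rV[R]_q) : R :=
    'd (fun y : 'rV[R]_n => inner (p z.1.1) (phi z.1.1 y z.2) - f z.1.1 y z.2) (z.1.2) v.
  suff : {within D, continuous g2} by exact.
  apply: (@within_eq_continuous _ _ D g1).
    by move=> [[t y] u] Dz; rewrite /g1 /g2 hamiltonian_diff.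
  apply: within_continuousB; last exact: fdc.
  by apply: within_continuous_inner => //; exact: phidc.
Qed.
End pontryagin_C1.

(** The coordinates have their own constants and radii; the constants are added, and the minimum of
    the radii starts from [gam / 2] to stay below [gam]. *)
Lemma tube_lipschitz_rV (R : realType) n q l (t0 t1 gam M : R) (x : R -> 'rV[R]_n)
    (h : R -> 'rV[R]_n -> 'rV[R]_q -> 'rV[R]_l) :
  0 < gam -> {within `[t0, t1], continuous x} -> continuous_C1x (tube t0 t1 gam x) h ->
  exists2 C : R, 0 <= C & exists2 rho : R, 0 < rho < gam &
  forall t (u : 'rV[R]_q) y z, t0 <= t <= t1 -> `|u| <= M ->
    `|y - x t| <= rho -> `|z - x t| <= rho -> `|h t y u - h t z u| <= C * `|y - z|.
Proof.
move=> gam0 xc hC1.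
have /choice[Cr CrP] : forall i : 'I_l, exists Cr : R * R, [/\ 0 <= Cr.1, 0 < Cr.2 < gam &
    forall t (u : 'rV[R]_q) y z, t0 <= t <= t1 -> `|u| <= M ->
    `|y - x t| <= Cr.2 -> `|z - x t| <= Cr.2 ->
    `|h t y u 0 i - h t z u 0 i| <= Cr.1 * `|y - z|].
  move=> i; have [C C0 [rho rho0 CP]] :=
    tube_lipschitz M gam0 xc (continuous_C1x_coord i hC1).
  by exists (C, rho).
have sum0 : 0 <= \sum_i (Cr i).1 by apply: sumr_ge0 => i _; have [] := CrP i.
exists (\sum_i (Cr i).1) => //.
exists (\big[Num.min/(gam / 2)]_i (Cr i).2).
  apply/andP; split.
    apply: lt_bigmin => [|i _]; first by rewrite divr_gt0.
    by have [_ /andP[]] := CrP i.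
  apply: le_lt_trans (bigmin_le_id _ _ _ _) _.
  by rewrite ltr_pdivrMr// ltr_pMr// ltr1n.
move=> t u y z tI uM yr zr; apply: rV_norm_le => [|i]; first by rewrite mulr_ge0.
rewrite !mxE; have [_ _ CP] := CrP i.
apply: (@le_trans _ _ ((Cr i).1 * `|y - z|)).
  by apply: CP => //; [apply: le_trans yr _|apply: le_trans zr _]; exact: bigmin_le_cond.
rewrite ler_wpM2r// (bigD1 i)//= lerDl sumr_ge0// => j _; by have [] := CrP j.
Qed.

(** Only the component [s] is replaced on the window, so the values stay in the product of the [U s]
    and the other components stay piecewise continuous. *)
Definition needle_control (R : realType) k (m : 'I_k -> nat)
    (u : R -> forall s : 'I_k, 'rV[R]_(m s)) (s : 'I_k) (v : 'rV[R]_(m s)) (tau lam t : R) :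
    forall s : 'I_k, 'rV[R]_(m s) :=
  if tau <= t < tau + lam then dfwith (u t) s v else u t.

Section chi_comp_theory.
Context (R : realType) (k n : nat) (m : 'I_k -> nat).
Implicit Types (A : 'I_k -> set R) (u : R -> forall s : 'I_k, 'rV[R]_(m s)).

(** On the window the component [s] alone is active. Decomposition and control use the same
    half-open window, so the identity holds at every [t], the ends included. *)
Lemma chi_comp_needle (W : lmodType R) A
    (h : forall s : 'I_k, R -> 'rV[R]_n -> 'rV[R]_(m s) -> W) u s (v : 'rV[R]_(m s))
    (tau lam t : R) (y : 'rV[R]_n) :
  chi_comp (needle A s tau lam) h t y (needle_control u v tau lam t) =
  if tau <= t < tau + lam then h s t y v else chi_comp A h t y (u t).
Proof.
rewrite /chi_comp /needle_control; case: ifPn => tN.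
  have Nt : `[tau, tau + lam[%classic t by rewrite /= in_itv.
  rewrite (bigD1 s)//= dfwithin big1 ?addr0.
    by rewrite indicE /needle eqxx mem_set ?scale1r//; right.
  move=> s' s's; rewrite indicE /needle (negbTE s's) memNset ?scale0r//.
  by move=> [_]; exact.
apply: eq_bigr => s' _; congr (_ *: _).
have Nt : ~ `[tau, tau + lam[%classic t by rewrite /= in_itv; exact/negP.
rewrite !indicE /needle; case: ifPn => [/eqP ->|_]; congr (_%:R); congr nat_of_bool;
  apply/idP/idP => /set_mem At; apply/mem_set.
- by case: At.
- by left.
- by case: At.
- by split.
Qed.

Lemma pontryaginM_chi (f : forall s : 'I_k, R -> 'rV[R]_n -> 'rV[R]_(m s) -> R)
    (phi : forall s : 'I_k, R -> 'rV[R]_n -> 'rV[R]_(m s) -> 'rV[R]_n) t x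
    (u : forall s : 'I_k, 'rV[R]_(m s)) p A :
  pontryaginM f phi t x u p A =
  inner p (chi_comp A phi t x u) - chi_comp (W := R^o) A f t x u.
Proof.
rewrite /pontryaginM /chi_comp inner_sumr -sumrB; apply: eq_bigr => s _.
by rewrite innerZr /pontryagin mulrBr.
Qed.

Lemma chi_comp_pcontinuous (W : normedModType R) (t0 t1 gam : R) (xs x : R -> 'rV[R]_n) A u
    (h : forall s : 'I_k, R -> 'rV[R]_n -> 'rV[R]_(m s) -> W) (E : seq R) :
  (forall c, c \in E -> t0 < c < t1) ->
  (forall s, {within tube t0 t1 gam xs, continuous (fun z => h s z.1.1 z.1.2 z.2)}) ->
  {within `[t0, t1], continuous x} ->
  (forall t, t0 <= t <= t1 -> `|x t - xs t| < gam) ->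
  (forall s, pcontinuous_at t0 t1 E (\1_(A s) : R -> R)) ->
  (forall s, pcontinuous_at t0 t1 E (fun t => u t s)) ->
  pcontinuous_at t0 t1 E (fun t => chi_comp A h t (x t) (u t)).
Proof.
move=> Eab hc xc xg AE uE; apply: pcontinuous_at_sum => // s.
apply: pcontinuous_atZ => //.
exact: (pcontinuous_at_tube (hc s) xc xg (uE s)).
Qed.

Lemma norm_chi_comp_le (W : normedModType R) A
    (h : forall s : 'I_k, R -> 'rV[R]_n -> 'rV[R]_(m s) -> W) (C : 'I_k -> R) t x
    (u : forall s : 'I_k, 'rV[R]_(m s)) :
  (forall s, `|h s t x (u s)| <= C s) -> `|chi_comp A h t x u| <= \sum_s C s.
Proof.
move=> hC; apply: le_trans (ler_norm_sum _ _ _) _; apply: ler_sum => s _.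
rewrite normrZ indicE; apply: le_trans _ (hC s).
by rewrite ler_piMl// normr_nat; case: (_ \in _); rewrite ?ler01.
Qed.

Lemma chi_compB (W : lmodType R) A
    (h h' : forall s : 'I_k, R -> 'rV[R]_n -> 'rV[R]_(m s) -> W) t x x'
    (u u' : forall s : 'I_k, 'rV[R]_(m s)) :
  chi_comp A h t x u - chi_comp A h' t x' u' =
  chi_comp A (fun s t y v => h s t x (u s) - h' s t x' (u' s)) t x u.
Proof. by rewrite /chi_comp -sumrB; apply: eq_bigr => s _; rewrite scalerBr. Qed.

End chi_comp_theory.

(** * Linear backward equations and the adjoint *)

Section time_reversal.
Context (R : realType) (a b : R).
(** The reflection of [[a, b]], in the shape [c * t + d] that the affine lemmas expect. *)
Let rev (t : R) : R := -1 * t + (a + b).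

Lemma reverse_itv t : (a <= rev t <= b) = (a <= t <= b).
Proof. by rewrite /rev; apply/andP/andP => -[]; split; lra. Qed.

Lemma reverse_itvoo t : (a < rev t < b) = (a < t < b).
Proof. by rewrite /rev; apply/andP/andP => -[]; split; lra. Qed.

Lemma reverseK t : rev (rev t) = t.
Proof. by rewrite /rev; ring. Qed.

Lemma within_continuous_reverse (T : topologicalType) (y : R -> T) :
  {within `[a, b], continuous y} -> {within `[a, b], continuous (fun t => y (rev t))}.
Proof.
move=> yc; apply: (@within_continuous_comp _ _ _ `[a, b]%classic `[a, b]%classic rev y) => //.
  by apply: continuous_subspaceT; exact: affine_continuous.
by move=> t; rewrite /= !in_itv/= reverse_itv.
Qed.

Lemma pw_bounded_continuous_reverse (V : normedModType R) (E : seq R) (g : R -> V) :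
  pw_bounded_continuous a b E g ->
  pw_bounded_continuous a b (map rev E) (fun t => g (rev t)).
Proof.
move=> [[M gM] gc]; split; first by exists M => t tI; apply: gM; rewrite reverse_itv.
move=> t tI tE; have h : {for rev t, continuous g}.
  apply: gc; first by rewrite reverse_itvoo.
  by apply: contra tE => tE; rewrite -(reverseK t) map_f.
exact: (cvg_comp _ g (@affine_continuous _ (-1) (a + b) t) h).
Qed.

Lemma reverse_is_derive n (q : R -> 'rV[R]_n) (dq : 'rV[R]_n) t :
  is_derive (rev t) 1 q dq -> is_derive t 1 (fun t => q (rev t)) (- dq).
Proof.
move=> /is_derive_rV qd; apply/is_derive_rV => i.
have h := @is_derive1_comp _ (fun s => q s 0 i) rev t _ _ (qd i) (affine_is_derive _ _ _).
by apply: (is_derive_eq h); rewrite mxE -[LHS]/(_ * _) mulrN1.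
Qed.
End time_reversal.

Lemma common_bound (R : realType) (I : finType) (T : Type) (V : normedModType R)
    (Q : T -> Prop) (g : I -> T -> V) :
  (forall i, exists M, forall t, Q t -> `|g i t| <= M) ->
  exists2 M : R, 0 <= M & forall i t, Q t -> `|g i t| <= M.
Proof.
move=> /choice[M gM]; exists (\sum_i `|M i|); first exact: sumr_ge0.
move=> i t Qt; apply: le_trans (gM i t Qt) _; apply: le_trans (ler_norm _) _.
by rewrite (bigD1 i)//= lerDl sumr_ge0.
Qed.

(** Reversing time turns the terminal condition into an initial one. The right-hand side is
    Lipschitz in [q] globally, so a solution exists on the whole interval. *)
Lemma linear_backward_ode (R : realType) n (t0 t1 : R) (E : seq R)
    (b : 'I_n -> R -> 'rV[R]_n) (c : 'I_n -> R -> R) : t0 < t1 ->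
  (forall e, e \in E -> t0 < e < t1) ->
  (forall j, pcontinuous_at t0 t1 E (b j)) -> (forall j, pcontinuous_at t0 t1 E (c j)) ->
  let G t (q : 'rV[R]_n) : 'rV[R]_n := \row_j (inner q (b j t) + c j t) in
  exists p : R -> 'rV[R]_n, [/\ {within `[t0, t1], continuous p}, p t1 = 0,
    forall t, t0 < t < t1 -> t \notin E -> is_derive t 1 p (G t (p t)) &
    pcontinuous_at t0 t1 E (fun t => G t (p t))].
Proof.
move=> t01 EI bE cE G; pose rev (t : R) : R := -1 * t + (t0 + t1).
have Gpc (p : R -> 'rV[R]_n) : {within `[t0, t1], continuous p} ->
    pcontinuous_at t0 t1 E (fun t => G t (p t)).
  move=> pc; have pE : pcontinuous_at t0 t1 E p.
    by apply: (pcontinuous_at_mono (within_continuous_pcontinuous_at pc) _ EI).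
  apply: pcontinuous_at_rV => // j.
  rewrite (_ : (fun t => _) = fun t => inner (p t) (b j t) + c j t).
    by apply: pcontinuous_atD => //; exact: pcontinuous_at_inner.
  by apply/funext => t; rewrite mxE.
pose F (r : R) (y : 'rV[R]_n) : 'rV[R]_n := - G (rev r) y.
have F_pw (y : R -> 'rV[R]_n) : {within `[t0, t1], continuous y} ->
    pw_bounded_continuous t0 t1 (map rev E) (fun t => F t (y t)).
  move=> yc; have H := Gpc _ (within_continuous_reverse yc).
  have := pw_bounded_continuous_reverse (pcontinuous_at_pw_bounded (pcontinuous_atN H)).
  rewrite (_ : (fun t => _) = fun t => F t (y t))//.
  by apply/funext => t; rewrite reverseK.
have [M M0 bM] : exists2 M : R, 0 <= M & forall j t, t0 <= t <= t1 -> `|b j t| <= M.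
  by apply: common_bound => j; exact: (pcontinuous_at_bounded (bE j)).
pose L := n%:R * M + 1.
have L0 : 0 < L by rewrite ltr_wpDl// mulr_ge0.
have F_lip t (y z : 'rV[R]_n) : t0 <= t <= t1 -> `|F t y - F t z| <= L * `|y - z|.
  move=> tI; apply: rV_norm_le => [|j]; first by rewrite mulr_ge0// ltW.
  have -> : (F t y - F t z) 0 j = - inner (y - z) (b j (rev t)).
    by rewrite !mxE [inner (y - z) _]innerC innerBr ![inner (b _ _) _]innerC; ring.
  rewrite normrN (le_trans (inner_norm_le _ _))// mulrAC ler_wpM2r//.
  rewrite (@le_trans _ _ (n%:R * M)) ?lerDl// ler_wpM2l// bM//.
  by rewrite reverse_itv.
have c0 : {within `[t0, t1], continuous (fun=> 0 : 'rV[R]_n)}.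
  by apply: continuous_subspaceT => t; exact: cvg_cst.
have [del delP] := pcontinuous_at_bounded
  (within_continuous_pcontinuous_at (primitive_continuous (ltW t01) (F_pw _ c0))).
have del0 : 0 <= del by rewrite (le_trans _ (delP t0 _))// lexx ltW.
(* The reference curve is 0 and [del] bounds its defect. Because the Lipschitz bound is global, the
   tube radius can be set to exactly the value that the smallness condition demands. *)
have [||||q [qc q0 qd _]] := @picard R n t0 t1 (map rev E) F (fun=> 0) 0 L
  (2 * del * expR (2 * L * (t1 - t0))) del (ltW t01) L0 del0 c0.
- by move=> t y z tI _ _; exact: F_lip.
- by move=> y yc _; exact: F_pw.
- by move=> t tI; rewrite add0r subr0; exact: delP.
- exact: lexx.
exists (fun t => q (rev t)); split.
- exact: within_continuous_reverse.
- by rewrite (_ : rev t1 = t0)// /rev; ring.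
- move=> t tI tE; rewrite -[G t _]opprK; apply: reverse_is_derive.
  have <- : F (rev t) (q (rev t)) = - G t (q (rev t)) by rewrite /F /rev reverseK.
  apply: (qd (rev t)); first by rewrite reverse_itvoo.
  by apply: contra tE => /mapP[e eE /(congr1 rev)]; rewrite /rev !reverseK => ->.
- by apply: Gpc; exact: within_continuous_reverse.
Qed.

Section adjoint.
Context (R : realType) (k n : nat) (m : 'I_k -> nat) (t0 t1 gam : R).
Variables (f : forall s : 'I_k, R -> 'rV[R]_n -> 'rV[R]_(m s) -> R).
Variables (phi : forall s : 'I_k, R -> 'rV[R]_n -> 'rV[R]_(m s) -> 'rV[R]_n).
Variables (xs : R -> 'rV[R]_n) (us : R -> forall s : 'I_k, 'rV[R]_(m s)).
Variables (As : 'I_k -> set R) (E : seq R).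
Hypotheses (t01 : t0 < t1) (gam0 : 0 < gam) (xs_cont : {within `[t0, t1], continuous xs}).
Hypothesis f_C1 : forall s, continuous_C1x (tube t0 t1 gam xs) (@f s).
Hypothesis phi_C1 : forall s, continuous_C1x (tube t0 t1 gam xs) (@phi s).
Hypothesis E_itv : forall c, c \in E -> t0 < c < t1.
Hypothesis As_E : forall s, pcontinuous_at t0 t1 E (\1_(As s) : R -> R).
Hypothesis us_E : forall s, pcontinuous_at t0 t1 E (fun t => us t s).

Let in_tube t s : t0 <= t <= t1 -> @tube R n (m s) t0 t1 gam xs (t, xs t, us t s).
Proof. by move=> tI; split; rewrite //= subrr normr0. Qed.

Let xs_in_tube t : t0 <= t <= t1 -> `|xs t - xs t| < gam.
Proof. by rewrite subrr normr0. Qed.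

Lemma pontryagin_diff t p s v : t0 <= t <= t1 ->
  differentiable (fun y => pontryagin f phi t y (us t s) p) (xs t) /\
  'd (fun y => pontryagin f phi t y (us t s) p) (xs t) v =
  inner p ('d (fun y => @phi s t y (us t s)) (xs t) v) -
  'd (fun y => @f s t y (us t s)) (xs t) v.
Proof.
move=> tI; have [_ /(_ _ (in_tube s tI)) fd _] := f_C1 s.
have [_ /(_ _ (in_tube s tI)) phid _] := phi_C1 s.
by have [dH HE] := inner_sub_diff p phid fd; split; [exact: dH|exact: HE].
Qed.

Lemma derive_pontryaginM t p v : t0 <= t <= t1 ->
  'D_v (fun y => pontryaginM f phi t y (us t) p As) (xs t) =
  \sum_s \1_(As s) t * 'd (fun y => pontryagin f phi t y (us t s) p) (xs t) v.
Proof.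
move=> tI.
pose H s (y : 'rV[R]_n) : R := pontryagin f phi t y (us t s) p.
have dH s : differentiable (H s) (xs t) by have [] := pontryagin_diff p s 0 tI.
have dZ s : derivable ((\1_(As s) t : R) \*: H s) (xs t) v.
  by apply: diff_derivable; exact: differentiableZ.
rewrite (_ : (fun y => _) = \sum_s ((\1_(As s) t : R) \*: H s)); last first.
  by apply/funext => y; rewrite fct_sumE.
rewrite derive_sum//; apply: eq_bigr => s _; rewrite deriveZ; last exact: diff_derivable.
by rewrite deriveE.
Qed.

Lemma inner_gradient_pontryaginM t p v : t0 <= t <= t1 ->
  inner (gradient (fun y => pontryaginM f phi t y (us t) p As) (xs t)) v =
  \sum_s \1_(As s) t * 'd (fun y => pontryagin f phi t y (us t s) p) (xs t) v.
Proof.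
move=> tI; rewrite /inner.
under eq_bigr => j _ do rewrite mxE derive_pontryaginM// mulr_suml.
rewrite exchange_big; apply: eq_bigr => s _.
rewrite (diff_rV_expand _ (xs t) v) mulr_sumr; apply: eq_bigr => j _.
by rewrite -mulrA; congr (_ * _); exact: mulrC.
Qed.

(** The Hamiltonian is affine in [p], so the adjoint equation is linear; its coefficients are
    piecewise continuous because the partial derivatives in [x] are continuous on the tube. *)
Lemma adjoint_exists : exists p pdot : R -> 'rV[R]_n,
  [/\ {within `[t0, t1], continuous p}, p t1 = 0, pcontinuous_at t0 t1 E pdot,
      forall t, t0 < t < t1 -> t \notin E -> is_derive t 1 p (pdot t) &
      forall t, t0 <= t <= t1 -> pdot t =
        - gradient (fun y => pontryaginM f phi t y (us t) (p t) As) (xs t)].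
Proof.
pose dphi (j : 'I_n) s t (y : 'rV[R]_n) v : 'rV[R]_n :=
  'd (fun y => @phi s t y v) y (delta_mx 0 j).
pose df (j : 'I_n) s t (y : 'rV[R]_n) v : R := 'd (fun y => @f s t y v) y (delta_mx 0 j).
(* With these coefficients the [j]-th coordinate of minus the gradient is
   [inner p (b j t) + c j t]. *)
pose b j t := - chi_comp As (dphi j) t (xs t) (us t).
pose c j t : R := chi_comp (W := R^o) As (df j) t (xs t) (us t).
have bE j : pcontinuous_at t0 t1 E (b j).
  apply: pcontinuous_atN; apply: (@chi_comp_pcontinuous _ _ _ _ _ _ _ gam xs) => //.
  by move=> s; have [_ _] := phi_C1 s; exact.
have cE j : pcontinuous_at t0 t1 E (c j).
  apply: (@chi_comp_pcontinuous _ _ _ _ R _ _ gam xs) => //.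
  by move=> s; have [_ _] := f_C1 s; exact.
have [p [pc p1 pd pdotE]] := linear_backward_ode t01 E_itv bE cE.
exists p, (fun t => \row_j (inner (p t) (b j t) + c j t)); split=> // t tI.
apply/rowP => j; rewrite !mxE derive_pontryaginM// /b innerNr /c /chi_comp inner_sumr.
rewrite -!sumrN -big_split; apply: eq_bigr => s _.
have [_ ->] := pontryagin_diff (p t) s (delta_mx 0 j) tI.
rewrite innerZr -[\1_(As s) t *: _]/(\1_(As s) t * _) /dphi /df.
by rewrite mulrBr opprB addrC.
Qed.
End adjoint.

(** * Needle variations *)

Section needle_variation.
Context (R : realType) (k n : nat) (m : 'I_k -> nat) (t0 t1 gam : R) (x0 : 'rV[R]_n).
Variables (f : forall s : 'I_k, R -> 'rV[R]_n -> 'rV[R]_(m s) -> R).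
Variables (phi : forall s : 'I_k, R -> 'rV[R]_n -> 'rV[R]_(m s) -> 'rV[R]_n).
Variables (xs : R -> 'rV[R]_n) (us : R -> forall s : 'I_k, 'rV[R]_(m s)).
Variables (As : 'I_k -> set R) (E : seq R).
Hypotheses (t01 : t0 < t1) (gam0 : 0 < gam) (xs_cont : {within `[t0, t1], continuous xs}).
Hypothesis f_C1 : forall s, continuous_C1x (tube t0 t1 gam xs) (@f s).
Hypothesis phi_C1 : forall s, continuous_C1x (tube t0 t1 gam xs) (@phi s).
Hypothesis E_itv : forall c, c \in E -> t0 < c < t1.
Hypothesis As_E : forall s, pcontinuous_at t0 t1 E (\1_(As s) : R -> R).
Hypothesis us_E : forall s, pcontinuous_at t0 t1 E (fun t => us t s).
Hypothesis xs_t0 : xs t0 = x0.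
Hypothesis xs_deriv : forall t, t0 < t < t1 -> t \notin E ->
  is_derive t 1 xs (chi_comp As phi t (xs t) (us t)).
Variables (tau : R) (s : 'I_k) (v : 'rV[R]_(m s)).
Hypotheses (tau_itv : t0 < tau < t1) (tauE : tau \notin E).

Let t0I : t0 <= t0 <= t1. Proof. by rewrite lexx ltW. Qed.
Let t1I : t0 <= t1 <= t1. Proof. by rewrite lexx ltW. Qed.

Let E' lam := [:: tau, tau + lam & E].

Let needle_of (V : Type) (lam : R) (g g' : R -> V) (t : R) : V :=
  if tau <= t < tau + lam then g t else g' t.

Let needle_pcontinuous (V : normedModType R) lam (g g' : R -> V) :
  0 < lam -> tau + lam < t1 -> pcontinuous_at t0 t1 E g -> pcontinuous_at t0 t1 E g' ->
  pcontinuous_at t0 t1 (E' lam) (needle_of lam g g').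
Proof.
move=> lam0 lamt1 gE g'E; apply: pcontinuous_at_window => //; last by rewrite ltrDl.
by case/andP: tau_itv.
Qed.

Let v_E : pcontinuous_at t0 t1 E (fun=> v).
Proof. by apply: (pcontinuous_at_mono (pcontinuous_at_cst _ _ v)). Qed.

Let values_bounded : exists2 M : R, `|v| <= M &
  forall s' t, t0 <= t <= t1 -> `|us t s'| <= M.
Proof.
have [M M0 usM] : exists2 M : R, 0 <= M & forall s' t, t0 <= t <= t1 -> `| `|us t s'| | <= M.
  apply: common_bound => s'; have [M uM] := pcontinuous_at_bounded (us_E s').
  by exists M => t tI; rewrite normr_id uM.
exists (`|v| + M); first by rewrite lerDl.
by move=> s' t tI; have := usM s' t tI; rewrite normr_id => /le_trans; apply; rewrite lerDr.
Qed.

Let rhs lam t (y : 'rV[R]_n) : 'rV[R]_n :=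
  needle_of lam (fun t => @phi s t y v) (fun t => chi_comp As phi t y (us t)) t.

Let rhs_pcontinuous lam (x : R -> 'rV[R]_n) : 0 < lam -> tau + lam < t1 ->
  {within `[t0, t1], continuous x} ->
  (forall t, t0 <= t <= t1 -> `|x t - xs t| < gam) ->
  pcontinuous_at t0 t1 (E' lam) (fun t => rhs lam t (x t)).
Proof.
move=> lam0 lamt1 xc xg; apply: needle_pcontinuous => //.
  by have [phic _ _] := phi_C1 s; exact: (pcontinuous_at_tube phic xc xg v_E).
by apply: (chi_comp_pcontinuous E_itv _ xc xg) => // s'; have [] := phi_C1 s'.
Qed.

Let xs_tube t : t0 <= t <= t1 -> `|xs t - xs t| < gam.
Proof. by rewrite subrr normr0. Qed.

(** The constants precede [lam]: a single [M] bounds [v] and all the reference controls, so the same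
    sum of Lipschitz constants works on and off any window. *)
Let rhs_lipschitz : exists2 L : R, 0 < L & exists2 rho : R, 0 < rho < gam &
  forall lam t y z, t0 <= t <= t1 -> `|y - xs t| <= rho -> `|z - xs t| <= rho ->
    `|rhs lam t y - rhs lam t z| <= L * `|y - z|.
Proof.
have [M vM usM] := values_bounded.
have /choice[Cr CrP] : forall s' : 'I_k, exists Cr : R * R, [/\ 0 <= Cr.1, 0 < Cr.2 < gam &
    forall t (u : 'rV[R]_(m s')) y z, t0 <= t <= t1 -> `|u| <= M ->
    `|y - xs t| <= Cr.2 -> `|z - xs t| <= Cr.2 ->
    `|phi t y u - phi t z u| <= Cr.1 * `|y - z|].
  move=> s'; have [C C0 [rho rho0 CP]] := tube_lipschitz_rV M gam0 xs_cont (phi_C1 s').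
  by exists (C, rho).
have C0 s' : 0 <= (Cr s').1 by have [] := CrP s'.
exists (\sum_s' (Cr s').1 + 1); first by rewrite ltr_wpDl// sumr_ge0.
exists (\big[Num.min/(gam / 2)]_s' (Cr s').2).
  apply/andP; split.
    by apply: lt_bigmin => [|i _]; [rewrite divr_gt0|have [_ /andP[]] := CrP i].
  apply: le_lt_trans (bigmin_le_id _ _ _ _) _.
  by rewrite ltr_pdivrMr// ltr_pMr// ltr1n.
move=> lam t y z tI yr zr.
have lip s' (u : 'rV[R]_(m s')) : `|u| <= M -> `|phi t y u - phi t z u| <= (Cr s').1 * `|y - z|.
  move=> uM; have [_ _ CP] := CrP s'.
  by apply: CP => //; [apply: le_trans yr _|apply: le_trans zr _]; exact: bigmin_le_cond.
apply: (@le_trans _ _ ((\sum_s' (Cr s').1) * `|y - z|)); last first.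
  by rewrite ler_wpM2r// lerDl.
rewrite /rhs /needle_of; case: ifPn => _.
  apply: le_trans (lip s v vM) _; rewrite ler_wpM2r// (bigD1 s)//= lerDl.
  by apply: sumr_ge0.
rewrite chi_compB mulr_suml; apply: norm_chi_comp_le => s'.
exact: lip (usM s' t tI).
Qed.

Let defect_bounded : exists2 B : R, 0 <= B & forall t, t0 <= t <= t1 ->
  `|phi t (xs t) v - chi_comp As phi t (xs t) (us t)| <= B.
Proof.
have [phic _ _] := phi_C1 s.
have h1 := pcontinuous_at_tube phic xs_cont xs_tube v_E.
have h2 : pcontinuous_at t0 t1 E (fun t => chi_comp As phi t (xs t) (us t)).
  by apply: (chi_comp_pcontinuous E_itv _ xs_cont xs_tube) => // s'; have [] := phi_C1 s'.
have [B BP] := pcontinuous_at_bounded (pcontinuous_atB h1 h2).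
exists B; last by move=> t tI; exact: BP.
exact: le_trans (BP t0 t0I).
Qed.

Lemma perturbed_trajectory : exists2 K : R, 0 < K & exists2 lam0 : R, 0 < lam0 &
  forall lam, 0 < lam < lam0 -> tau + lam < t1 /\ exists x : R -> 'rV[R]_n,
  [/\ {within `[t0, t1], continuous x}, x t0 = x0,
      forall t, t0 <= t <= t1 -> `|x t - xs t| <= K * lam,
      pcontinuous_at t0 t1 (E' lam) (fun t => rhs lam t (x t)) &
      forall t, t0 < t < t1 -> t \notin E' lam -> is_derive t 1 x (rhs lam t (x t))].
Proof.
have [L L0 [rho /andP[rho0 rhog] Lip]] := rhs_lipschitz.
have [B B0 BP] := defect_bounded.
pose e := expR (2 * L * (t1 - t0)); have e0 : 0 < e by exact: expR_gt0.
(* Picard's bound with defect [B * lam] is [2 * B * e * lam]; the added 1 makes [K] positive, so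
   that one may divide by it. *)
pose K := 2 * B * e + 1.
have K0 : 0 < K by rewrite ltr_wpDl// !mulr_ge0// ltW.
(* The first threshold keeps the window before [t1], the second keeps [K * lam] below the radius
   [rho] where the Lipschitz bound holds. *)
exists K => //; exists (Num.min (t1 - tau) (rho / K)).
  by rewrite lt_min subr_gt0 divr_gt0//; case/andP: tau_itv => _ ->.
move=> lam /andP[lam0]; rewrite lt_min ltr_pdivlMr// => /andP[lamt1 lamK].
have {}lamt1 : tau + lam < t1 by rewrite addrC -ltrBrDr.
split=> //.
have BlamK : 2 * (B * lam) * e <= K * lam.
  have -> : 2 * (B * lam) * e = (K - 1) * lam by rewrite /K; ring.
  by rewrite ler_wpM2r ?gerBl// ltW.
have tube_pw (y : R -> 'rV[R]_n) : {within `[t0, t1], continuous y} ->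
    (forall t, t0 <= t <= t1 -> `|y t - xs t| <= rho) ->
    pcontinuous_at t0 t1 (E' lam) (fun t => rhs lam t (y t)).
  by move=> yc yr; apply: rhs_pcontinuous => // t tI; exact: le_lt_trans (yr t tI) rhog.
have xs_rho t : t0 <= t <= t1 -> `|xs t - xs t| <= rho.
  by move=> _; rewrite subrr normr0 ltW.
have xs_pw := pcontinuous_at_pw_bounded (tube_pw xs xs_cont xs_rho).
(* The curve [xs] satisfies the perturbed equation off the window, and on it the velocities differ
   by at most [B]; hence a defect of at most [B * lam]. *)
have xs_almost t : t0 <= t <= t1 ->
    `|x0 + primitive t0 (fun s => rhs lam s (xs s)) t - xs t| <= B * lam.
  move=> tI; pose g t := x0 + primitive t0 (fun s => rhs lam s (xs s)) t - xs t.
  have g0 : g t0 = 0 by rewrite /g primitive_left addr0 xs_t0 subrr.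
  have := @rV_window_increment_le _ _ (E' lam) g
    (fun t => rhs lam t (xs t) - chi_comp As phi t (xs t) (us t))
    t0 t1 tau (tau + lam) B _ (ltW lamt1) B0 _ _ _ t tI.
  have lamE : tau + lam - tau = lam by rewrite addrC addKr.
  rewrite g0 subr0 lamE; apply.
  - by move: tau_itv => /andP[? ?]; apply/andP; split; lra.
  - apply: within_continuousB => //; apply: within_continuousD.
      by apply: continuous_subspaceT => r; exact: cvg_cst.
    exact: primitive_continuous (ltW t01) xs_pw.
  - move=> r rI rE.
    have h1 := primitive_is_derive xs_pw rI rE.
    have h2 : is_derive r 1 xs (chi_comp As phi r (xs r) (us r)).
      by apply: xs_deriv => //; apply: contra rE => rE; rewrite !inE rE !orbT.
    have h3 := is_deriveB (is_deriveD (is_derive_cst x0 r 1) h1) h2.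
    by apply: (is_derive_eq h3); rewrite add0r.
  - move=> r rI; rewrite !inE !negb_or => /and3P[rtau _ _].
    have rI' : t0 <= r <= t1 by case/andP: rI => ? ?; rewrite !ltW.
    rewrite /rhs /needle_of.
    (* The window in [rhs] contains [tau] while the increment estimate uses the open one; [tau] is
       an exceptional point, so the two agree here. *)
    have -> : (tau <= r) = (tau < r) by rewrite le_eqVlt eq_sym (negbTE rtau).
    by case: (tau < r < tau + lam); [exact: BP|rewrite subrr normr0].
have [||||x [xc xt0 xd xK]] := @picard R n t0 t1 (E' lam) (rhs lam) xs x0 L rho (B * lam)
  (ltW t01) L0 (mulr_ge0 B0 (ltW lam0)) xs_cont.
- by move=> t y z tI yr zr; exact: Lip.
- by move=> y yc yr; exact: pcontinuous_at_pw_bounded (tube_pw y yc yr).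
- exact: xs_almost.
- by rewrite -/e (le_trans BlamK)// mulrC ltW.
have xKl t : t0 <= t <= t1 -> `|x t - xs t| <= K * lam.
  by move=> tI; rewrite (le_trans (xK t tI)).
exists x; split=> //; apply: tube_pw => // t tI.
by rewrite (le_trans (xKl t tI))// mulrC ltW.
Qed.

Variables (U : forall s : 'I_k, set 'rV[R]_(m s)) (p pdot : R -> 'rV[R]_n).
Hypothesis us_U : forall t s, t0 <= t <= t1 -> @U s (us t s).
Hypothesis v_U : @U s v.
Hypothesis needle_dec : exists2 del : R, 0 < del & forall lam, 0 < lam < del ->
  decomposition `[t0, t1] (needle As s tau lam).
Hypotheses (p_cont : {within `[t0, t1], continuous p}) (p_t1 : p t1 = 0).
Hypothesis pdot_E : pcontinuous_at t0 t1 E pdot.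
Hypothesis p_deriv : forall t, t0 < t < t1 -> t \notin E -> is_derive t 1 p (pdot t).
Hypothesis pdotE : forall t, t0 <= t <= t1 -> pdot t =
  - gradient (fun y => pontryaginM f phi t y (us t) (p t) As) (xs t).
Hypothesis minimal : exists2 eps : R, 0 < eps & forall x u A,
  admissible t0 t1 x0 phi U x u A -> sup_dist t0 t1 x xs < eps ->
  cost t0 t1 f xs us As <= cost t0 t1 f x u A.

Let Hp s' t (y : 'rV[R]_n) (u : 'rV[R]_(m s')) : R := pontryagin f phi t y u (p t).

Let Hp_C1 s' : continuous_C1x (tube t0 t1 gam xs) (@Hp s').
Proof. exact: (continuous_C1x_hamiltonian p_cont (f_C1 s') (phi_C1 s')). Qed.

Let needle_admissible lam (x : R -> 'rV[R]_n) :
  0 < lam -> tau + lam < t1 -> decomposition `[t0, t1] (needle As s tau lam) ->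
  {within `[t0, t1], continuous x} -> x t0 = x0 ->
  pcontinuous_at t0 t1 (E' lam) (fun t => rhs lam t (x t)) ->
  (forall t, t0 < t < t1 -> t \notin E' lam -> is_derive t 1 x (rhs lam t (x t))) ->
  admissible t0 t1 x0 phi U x (needle_control us v tau lam) (needle As s tau lam).
Proof.
move=> lam0 lamt1 dec xc xt0 xE xd; split=> //.
- exists (fun t => rhs lam t (x t)); first by split=> //; exists (E' lam).
  by move=> t _; rewrite chi_comp_needle.
- move=> s'; exists (E' lam); have [ss'|ss'] := eqVneq s s'.
    subst s'; have := needle_pcontinuous lam0 lamt1 v_E (us_E s).
    rewrite (_ : needle_of _ _ _ = fun t => needle_control us v tau lam t s)//.
    by apply/funext => t; rewrite /needle_of /needle_control; case: ifPn; rewrite ?dfwithin.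
  have := needle_pcontinuous lam0 lamt1 (us_E s') (us_E s').
  rewrite (_ : needle_of _ _ _ = fun t => needle_control us v tau lam t s')//.
  by apply/funext => t; rewrite /needle_of /needle_control; case: ifPn; rewrite ?dfwithout.
- move=> t s' tI; rewrite /needle_control; case: ifPn => _; last exact: us_U.
  by case: dfwithP => [//|j _]; exact: us_U.
Qed.

Let sup_dist_le (x : R -> 'rV[R]_n) (d : R) :
  (forall t, t0 <= t <= t1 -> `|x t - xs t| <= d) -> sup_dist t0 t1 x xs <= d.
Proof.
move=> xd; apply: ge_sup; first by exists `|x t0 - xs t0|, t0; rewrite //= in_itv.
by move=> _ [t + <-]; rewrite /= in_itv/=; exact: xd.
Qed.

Let running lam (x : R -> 'rV[R]_n) (t : R) : R :=
  needle_of lam (fun t => @f s t (x t) v) (fun t => chi_comp (W := R^o) As f t (x t) (us t)) t.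

Let running_pcontinuous lam (x : R -> 'rV[R]_n) : 0 < lam -> tau + lam < t1 ->
  {within `[t0, t1], continuous x} ->
  (forall t, t0 <= t <= t1 -> `|x t - xs t| < gam) ->
  pcontinuous_at t0 t1 (E' lam) (running lam x).
Proof.
move=> lam0 lamt1 xc xg; apply: needle_pcontinuous => //.
  by have [fc _ _] := f_C1 s; exact: (pcontinuous_at_tube fc xc xg v_E).
apply: (@chi_comp_pcontinuous _ _ _ _ R _ _ _ _ _ _ _ _ _ E_itv _ xc xg) => //.
by move=> s'; have [] := f_C1 s'.
Qed.

(* Derivative in [t] of the running cost increment minus [<p, x - xs>]. *)
Let gap lam (x : R -> 'rV[R]_n) (t : R) : R :=
  running lam x t - chi_comp (W := R^o) As f t (xs t) (us t) -
  (inner (pdot t) (x t - xs t) +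
   inner (p t) (rhs lam t (x t) - chi_comp As phi t (xs t) (us t))).

Let gap_off_needle lam x t : t0 <= t <= t1 -> ~~ (tau <= t < tau + lam) ->
  gap lam x t = - \sum_s' \1_(As s') t * (@Hp s' t (x t) (us t s') - @Hp s' t (xs t) (us t s') -
    'd (fun y => @Hp s' t y (us t s')) (xs t) (x t - xs t)).
Proof.
move=> tI tN; rewrite /gap /running /rhs /needle_of (negbTE tN) pdotE//.
rewrite [inner (- _) _]innerC innerNr [inner _ (gradient _ _)]innerC.
rewrite (inner_gradient_pontryaginM us As gam0 f_C1 phi_C1)//.
have -> : \sum_s' \1_(As s') t * (@Hp s' t (x t) (us t s') - @Hp s' t (xs t) (us t s') -
      'd (fun y => @Hp s' t y (us t s')) (xs t) (x t - xs t)) =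
    pontryaginM f phi t (x t) (us t) (p t) As - pontryaginM f phi t (xs t) (us t) (p t) As -
    \sum_s' \1_(As s') t * 'd (fun y => @Hp s' t y (us t s')) (xs t) (x t - xs t).
  rewrite /pontryaginM -!sumrB; apply: eq_bigr => s' _; rewrite !mulrBr.
  by congr (_ - _).
rewrite !pontryaginM_chi [inner (p t) (_ - _)]innerBr; move: (\sum_s' _) => d; ring.
Qed.

(** The term with [pdot] is left as it is: on the window [x - xs] is of order [lam], so a crude
    bound on [pdot] makes it negligible. *)
Let gap_on_needle lam x t : tau <= t < tau + lam ->
  gap lam x t = - @Hp s t (x t) v + pontryaginM f phi t (xs t) (us t) (p t) As -
    inner (pdot t) (x t - xs t).
Proof.
move=> tN; rewrite /gap /running /rhs /needle_of tN [inner (p t) _]innerBr pontryaginM_chi.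
rewrite /Hp /pontryagin.
ring.
Qed.

(** The increment is presented through an antiderivative of [gap], so pointwise bounds on [gap] can
    be fed straight into [window_increment_le]. *)
Let cost_increment lam x : 0 < lam -> tau + lam < t1 ->
  {within `[t0, t1], continuous x} -> x t0 = x0 ->
  (forall t, t0 <= t <= t1 -> `|x t - xs t| < gam) ->
  (forall t, t0 < t < t1 -> t \notin E' lam -> is_derive t 1 x (rhs lam t (x t))) ->
  exists2 I : R -> R,
    {within `[t0, t1], continuous I} /\
    (forall t, t0 < t < t1 -> t \notin E' lam -> is_derive t 1 I (gap lam x t)) &
    I t1 - I t0 = cost t0 t1 f x (needle_control us v tau lam) (needle As s tau lam) -
      cost t0 t1 f xs us As.
Proof.
move=> lam0 lamt1 xc xt0 xg xd.
pose f0 t : R := chi_comp (W := R^o) As f t (xs t) (us t).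
have pw1 := pcontinuous_at_pw_bounded (running_pcontinuous lam0 lamt1 xc xg).
have f0E : pcontinuous_at t0 t1 E f0.
  apply: (@chi_comp_pcontinuous _ _ _ _ R _ _ _ _ _ _ _ _ _ E_itv _ xs_cont xs_tube) => //.
  by move=> s'; have [] := f_C1 s'.
have pw2 := pcontinuous_at_pw_bounded f0E.
pose I1 t := \int[lebesgue_measure]_(r in `[t0, t]) running lam x r.
pose I2 t := \int[lebesgue_measure]_(r in `[t0, t]) f0 r.
exists (fun t => I1 t - I2 t - inner (p t) (x t - xs t)); first split.
- apply: within_continuousB; last first.
    by apply: within_continuous_inner => //; exact: within_continuousB.
  apply: within_continuousB.
    exact: Rintegral_within_continuous (ltW t01) pw1.
  exact: Rintegral_within_continuous (ltW t01) pw2.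
- move=> t tI tE'; have tE : t \notin E by apply: contra tE' => tE; rewrite !inE tE !orbT.
  have h1 := Rintegral_is_derive pw1 tI tE'.
  have h2 := Rintegral_is_derive pw2 tI tE.
  have h3 := inner_is_derive (p_deriv tI tE) (is_deriveB (xd t tI tE') (xs_deriv tI tE)).
  exact: is_deriveB (is_deriveB h1 h2) h3.
rewrite p_t1 xt0 xs_t0 subrr inner0r [inner 0 _]innerC inner0r !subr0.
rewrite {2}/I1 {2}/I2 set_itv1 !Rintegral_set1 !subr0 /cost /I1 /I2; congr (_ - _).
by apply: eq_Rintegral => t _; rewrite chi_comp_needle.
Qed.

Let Hp_taylor (M eta : R) : 0 < eta -> exists2 rho : R, 0 < rho &
  forall s' t (u : 'rV[R]_(m s')) y, t0 <= t <= t1 -> `|u| <= M -> `|y - xs t| <= rho ->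
  `|Hp t y u - Hp t (xs t) u - 'd (fun y => Hp t y u) (xs t) (y - xs t)| <= eta * `|y - xs t|.
Proof.
move=> eta0.
have /choice[rho rhoP] : forall s' : 'I_k, exists rho : R, 0 < rho /\
    forall t (u : 'rV[R]_(m s')) y, t0 <= t <= t1 -> `|u| <= M -> `|y - xs t| <= rho ->
    `|Hp t y u - Hp t (xs t) u - 'd (fun y => Hp t y u) (xs t) (y - xs t)|
      <= eta * `|y - xs t|.
  move=> s'; have [rho /andP[rho0 _] rhoP] := tube_taylor M gam0 xs_cont (Hp_C1 s') eta0.
  by exists rho; split; [exact: rho0|exact: rhoP].
exists (\big[Num.min/1]_s' rho s').
  by apply: lt_bigmin => // s' _; have [] := rhoP s'.
move=> s' t u y tI uM yr; have [_ H] := rhoP s'; apply: H => //.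
by apply: le_trans yr _; exact: bigmin_le_cond.
Qed.

(** This is where [tau] must avoid [E]: continuity at [tau] lets the excess found there govern the
    whole short window. *)
Let Hp_gap_continuous : {for tau, continuous (fun t =>
  Hp t (xs t) v - pontryaginM f phi t (xs t) (us t) (p t) As)}.
Proof.
have pE : pcontinuous_at t0 t1 E p.
  by apply: (pcontinuous_at_mono (within_continuous_pcontinuous_at p_cont)).
have phiE : pcontinuous_at t0 t1 E (fun t => chi_comp As phi t (xs t) (us t)).
  by apply: (chi_comp_pcontinuous E_itv _ xs_cont xs_tube) => // s'; have [] := phi_C1 s'.
have fE : pcontinuous_at t0 t1 E (fun t => chi_comp (W := R^o) As f t (xs t) (us t) : R).
  apply: (@chi_comp_pcontinuous _ _ _ _ R _ _ _ _ _ _ _ _ _ E_itv _ xs_cont xs_tube) => //.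
  by move=> s'; have [] := f_C1 s'.
have [Hc _ _] := Hp_C1 s.
have HE := pcontinuous_at_tube Hc xs_cont xs_tube v_E.
have ME := pcontinuous_atB (pcontinuous_at_inner pE phiE) fE.
have := pcontinuous_at_interior (pcontinuous_atB HE ME) tau_itv tauE.
rewrite (_ : (fun t => _ - (inner _ _ - _)) = fun t =>
  Hp t (xs t) v - pontryaginM f phi t (xs t) (us t) (p t) As)//.
by apply/funext => t; rewrite pontryaginM_chi.
Qed.

Lemma needle_inequality : pontryagin f phi tau (xs tau) v (p tau) <=
  pontryaginM f phi tau (xs tau) (us tau) (p tau) As.
Proof.
rewrite leNgt -subr_gt0; apply/negP.
(* [Delta] is the supposed positive excess of [H_s] at [v] over the reference value; the needle will
   lower the cost by at least a fixed fraction of [Delta * lam]. *)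
set Delta := (X in 0 < X) => Delta0.
have [K K0 [lam0 lam00 traj]] := perturbed_trajectory.
have [M vM usM] := values_bounded.
have [C1 C10 [rho1 /andP[rho10 _] lipH]] := tube_lipschitz M gam0 xs_cont (Hp_C1 s).
have [Pb PbP] := pcontinuous_at_bounded pdot_E.
have Pb0 : 0 <= Pb := le_trans (normr_ge0 _) (PbP t0 t0I).
pose T := t1 - t0; have T0 : 0 < T by rewrite subr_gt0.
(* The contribution off the window is at most [k * eta * K * lam * T], which this choice limits to
   [Delta / 4 * lam]; the added 1 keeps the denominator positive. *)
pose eta := Delta / (4 * (k%:R * K * T + 1)).
have kKT0 : 0 <= k%:R * K * T by rewrite !mulr_ge0// ltW.
have eta0 : 0 < eta by rewrite divr_gt0// mulr_gt0// ltr_wpDl.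
have [rho2 rho20 taylorH] := Hp_taylor M eta0.
have [del del0 dec] := needle_dec.
have [eps eps0 minE] := minimal.
have Delta4 : 0 < Delta / 4 by rewrite divr_gt0.
have /cvgrPdist_lt/(_ _ Delta4)/nbhs_ballP[d0 /= d00 near_tau] := Hp_gap_continuous.
(* [C2 * K * lam] bounds the two errors on the window that come from [x] differing from [xs]: the
   Lipschitz one in [H_s] and the one from [pdot]. *)
pose C2 := C1 + n%:R * Pb.
have C20 : 0 <= C2 by rewrite addr_ge0// mulr_ge0.
have divK (r : R) : 0 < r -> 0 < r / K by move=> r0; rewrite divr_gt0.
have C2K0 : 0 < 4 * (C2 * K + 1) by rewrite mulr_gt0// ltr_wpDl// mulr_ge0// ltW.
near (0 : R)^'+ => lam.
have lam_gt0 : 0 < lam by near: lam; exact: nbhs_right_gt.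
have lam_lam0 : lam < lam0 by near: lam; exact: nbhs_right_lt.
have lam_del : lam < del by near: lam; exact: nbhs_right_lt.
have lam_d0 : lam < d0 by near: lam; exact: nbhs_right_lt.
have lam_gam : lam < gam / K by near: lam; exact: nbhs_right_lt (divK _ _).
have lam_rho1 : lam < rho1 / K by near: lam; exact: nbhs_right_lt (divK _ _).
have lam_rho2 : lam < rho2 / K by near: lam; exact: nbhs_right_lt (divK _ _).
have lam_eps : lam < eps / K by near: lam; exact: nbhs_right_lt (divK _ _).
have lam_C2 : lam < Delta / (4 * (C2 * K + 1)).
  by near: lam; apply: nbhs_right_lt; exact: divr_gt0.
rewrite !ltr_pdivlMr// ![lam * K]mulrC in lam_gam lam_rho1 lam_rho2 lam_eps lam_C2.
have [|lamt1 [x [xc xt0 xK xE xd]]] := traj lam; first by rewrite lam_gt0.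
have {}dec : decomposition `[t0, t1] (needle As s tau lam) by apply: dec; rewrite lam_gt0.
have xg t : t0 <= t <= t1 -> `|x t - xs t| < gam.
  by move=> tI; exact: le_lt_trans (xK t tI) lam_gam.
have adm := needle_admissible lam_gt0 lamt1 dec xc xt0 xE xd.
have cost_le := minE _ _ _ adm (le_lt_trans (sup_dist_le xK) lam_eps).
have [I [Ic Id] IE] := cost_increment lam_gt0 lamt1 xc xt0 xg xd.
(* The leading value [- Delta] is disturbed by at most [Delta / 4] through the displacement of [x]
   and by less than [Delta / 4] through moving from [tau] to [t]. *)
have on_needle t : tau < t < tau + lam -> gap lam x t <= - (Delta / 2).
  move=> /andP[taut ttau].
  have tN : tau <= t < tau + lam by rewrite ltW.
  have tI : t0 <= t <= t1.
    by case/andP: tau_itv => t0tau _; rewrite !ltW// ?(lt_trans t0tau)// (lt_trans ttau).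
  rewrite gap_on_needle//.
  have h1 : `|Hp t (x t) v - Hp t (xs t) v| <= C1 * (K * lam).
    apply: (@le_trans _ _ (C1 * `|x t - xs t|)); last by rewrite ler_wpM2l// xK.
    apply: lipH => //; last by rewrite subrr normr0 ltW.
    by rewrite (le_trans (xK t tI))// ltW.
  have h2 : `|inner (pdot t) (x t - xs t)| <= n%:R * Pb * (K * lam).
    apply: le_trans (inner_norm_le _ _) _; apply: ler_pM => //; last exact: xK.
    by rewrite ler_wpM2l// PbP.
  have h3 : `|Delta - (Hp t (xs t) v - pontryaginM f phi t (xs t) (us t) (p t) As)| < Delta / 4.
    apply: near_tau; rewrite /ball/= ltr_distlC.
    by rewrite ltrBlDr (lt_trans taut) ?ltrDl// (lt_trans ttau) ?ltrD2l.
  have h4 : C2 * (K * lam) <= Delta / 4 by lra.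
  move: h1 h2 h3; rewrite /C2 in h4.
  move: (Hp t (x t) v) (Hp t (xs t) v) (inner _ _)
    (pontryaginM _ _ _ _ _ _ _) => r1 r2 r3 r4.
  rewrite !ler_norml ltr_norml => /andP[? ?] /andP[? ?] /andP[? ?].
  have : C1 * (K * lam) + n%:R * Pb * (K * lam) <= Delta / 4 by rewrite -mulrDl.
  lra.
have off_needle t : t0 <= t <= t1 -> ~~ (tau <= t < tau + lam) ->
    gap lam x t <= k%:R * eta * (K * lam).
  move=> tI tN; rewrite gap_off_needle//.
  apply: le_trans (ler_norm _) _; rewrite normrN; apply: le_trans (ler_norm_sum _ _ _) _.
  apply: (@le_trans _ _ (\sum_(s' < k) eta * (K * lam))); last first.
    by rewrite sumr_const card_ord -mulrA mulr_natl.
  apply: ler_sum => s' _; rewrite normrM.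
  apply: (@le_trans _ _ (1 * (eta * `|x t - xs t|))); last by rewrite mul1r ler_pM2l// xK.
  apply: ler_pM => //.
    by rewrite indicE normr_nat; case: (_ \in _); rewrite ?ler01.
  apply: taylorH => //; first exact: usM.
  by rewrite (le_trans (xK t tI))// ltW.
have bound : I t1 - I t0 <= - (Delta / 2) * lam + k%:R * eta * (K * lam) * T.
  have {1}-> : lam = tau + lam - tau by rewrite addrC addKr.
  have [t0tau taut1] := andP tau_itv.
  apply: (window_increment_le (E := E' lam) (df := gap lam x)) => //.
  - by rewrite (ltW t0tau) lerDl ltW.
  - exact: ltW.
  - by rewrite (mulr_ge0 (mulr_ge0 _ (ltW eta0)) (mulr_ge0 (ltW K0) (ltW lam_gt0))).
  - by move=> t /on_needle.
  - move=> t /andP[t0t tt1]; rewrite !inE !negb_or => /and3P[ttau _ _] tN.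
    apply: off_needle; first by rewrite !ltW.
    by rewrite le_eqVlt eq_sym (negbTE ttau).
have etaT : k%:R * K * T * eta <= Delta / 4.
  rewrite /eta mulrA ler_pdivrMr; last by rewrite mulr_gt0// ltr_wpDl.
  have -> : Delta / 4 * (4 * (k%:R * K * T + 1)) = Delta * (k%:R * K * T) + Delta by field.
  by rewrite mulrC lerDl ltW.
(* The window gives at most [- (Delta / 2) * lam] and the remainder at most [Delta / 4 * lam], so
   the cost would strictly decrease. *)
have : k%:R * K * T * eta * lam <= Delta / 4 * lam by rewrite ler_wpM2r// ltW.
have : 0 < Delta * lam by rewrite mulr_gt0.
by move: bound cost_le; rewrite IE; lra.
Unshelve. all: by end_near. Qed.
End needle_variation.

(** * The maximum principle *)

Lemma finite_ae (R : realType) (F : seq R) (P : R -> Prop) :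
  (forall t, t \notin F -> P t) -> {ae (@lebesgue_measure R), forall t, P t}.
Proof.
move=> FP; exists [set` F]; split.
- by apply: countable_measurable; [exact: measurable_set1|exact/finite_set_countable/finite_seq].
- by apply: countable_lebesgue_measure0; exact/finite_set_countable/finite_seq.
- by move=> t /= nP; apply/negPn/negP => /FP.
Qed.

(** Exactly one component contains [t], so the sum reduces to the Hamiltonian of the active process;
    this gives the attainment half of the maximum condition. *)
Lemma pontryaginM_attained (R : realType) (k n : nat) (m : 'I_k -> nat) (t0 t1 : R)
    (f : forall s : 'I_k, R -> 'rV[R]_n -> 'rV[R]_(m s) -> R)
    (phi : forall s : 'I_k, R -> 'rV[R]_n -> 'rV[R]_(m s) -> 'rV[R]_n) t x
    (u : forall s : 'I_k, 'rV[R]_(m s)) p (A : 'I_k -> set R) :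
  decomposition `[t0, t1] A -> t0 <= t <= t1 ->
  exists s, pontryaginM f phi t x u p A = pontryagin f phi t x (u s) p.
Proof.
move=> [_ dA cA] tI; have : (\bigcup_s A s) t by rewrite cA /= in_itv.
move=> [s _ At]; exists s; rewrite /pontryaginM (bigD1 s)//= big1.
  by rewrite addr0 indicE mem_set// mul1r.
move=> s' s's; rewrite indicE memNset ?mul0r// => At'.
have : (A s' `&` A s) t by [].
by rewrite dA.
Qed.

Theorem theorem2p3 (R : realType) (k n : nat) (m : 'I_k -> nat)
    (t0 t1 : R) (ht : t0 < t1) (x0 : 'rV[R]_n)
    (f : forall s : 'I_k, R -> 'rV[R]_n -> 'rV[R]_(m s) -> R)
    (phi : forall s : 'I_k, R -> 'rV[R]_n -> 'rV[R]_(m s) -> 'rV[R]_n)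
    (U : forall s : 'I_k, set 'rV[R]_(m s))
    (hU : forall s : 'I_k, U s !=set0)
    (xs : R -> 'rV[R]_n) (us : R -> forall s : 'I_k, 'rV[R]_(m s))
    (As : 'I_k -> set R)
    (hadm : admissible t0 t1 x0 phi U xs us As)
    (hlip : lip t0 t1 f phi xs)
    (hmin : strong_local_min t0 t1 x0 f phi U xs us As) :
  exists p pdot : R -> 'rV[R]_n,
    [/\ PC1_derivative t0 t1 p pdot,
        forall t, t0 <= t <= t1 ->
          pdot t =
          - gradient (fun y => pontryaginM f phi t y (us t) (p t) As) (xs t),
        p t1 = 0 &
        {ae lebesgue_measure, forall t, t0 <= t <= t1 ->
          is_max
            [set h | exists s : 'I_k, exists2 v : 'rV[R]_(m s),
                       U s v & h = pontryagin f phi t (xs t) v (p t)]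
            (pontryaginM f phi t (xs t) (us t) (p t) As)}].

Proof.
have [[xdot [xs_cont [sx xdot_sx xs_deriv]] xdotE] xs_t0 us_PC us_U dec] := hadm.
have [gam gam0 C1] := hlip.
have f_C1 s : continuous_C1x (tube t0 t1 gam xs) (f s) by have [] := C1 s.
have phi_C1 s : continuous_C1x (tube t0 t1 gam xs) (phi s) by have [] := C1 s.
have [_ minimal] := hmin.
have /choice[su us_su] := us_PC.
have [sA As_sA] := decomposition_indicator ht dec.
have [sN needle_dec] := decomposition_needle dec.
(* One list of interior points serves the velocity, the indicators and all control components. *)
pose E := [seq c <- sx ++ sA ++ flatten [seq su s | s <- enum 'I_k] | t0 < c < t1].
have E_itv c : c \in E -> t0 < c < t1 by rewrite mem_filter => /andP[].
have in_E c : t0 < c < t1 ->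
    [\/ c \in sx, c \in sA | exists s, c \in su s] -> c \in E.
  move=> cI H; rewrite mem_filter cI !mem_cat.
  case: H => [->|->|[s cs]]; rewrite ?orbT//.
  apply/or3P/Or33/flattenP; exists (su s) => //; apply/mapP; exists s => //.
  by rewrite mem_enum.
have As_E s : pcontinuous_at t0 t1 E (\1_(As s) : R -> R).
  apply: (pcontinuous_at_mono (As_sA s)) => // c cs.
  by apply: in_E; [have [+ _ _ _] := As_sA s; exact|constructor 2].
have us_E s : pcontinuous_at t0 t1 E (fun t => us t s).
  apply: (pcontinuous_at_mono (us_su s)) => // c cs.
  by apply: in_E; [have [+ _ _ _] := us_su s; exact|constructor 3; exists s].
have xs_d t : t0 < t < t1 -> t \notin E ->
    is_derive t 1 xs (chi_comp As phi t (xs t) (us t)).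
  move=> tI tE; rewrite -xdotE; last by case/andP: tI => *; rewrite !ltW.
  by apply: xs_deriv => //; apply: contra tE => ts; apply: in_E => //; constructor 1.
have [p [pdot [p_cont p_t1 pdot_E p_deriv pdotE]]] :=
  adjoint_exists ht gam0 xs_cont f_C1 phi_C1 E_itv As_E us_E.
exists p, pdot; split=> //; first by split=> //; exists E.
(* Also excluded are the two ends of the interval and the points [sN], off which short needles are
   known to yield a decomposition. *)
apply: (@finite_ae _ [:: t0, t1 & E ++ sN]) => t.
rewrite !inE mem_cat !negb_or => /and4P[tt0 tt1 tE tN] tI.
have tIo : t0 < t < t1.
  by case/andP: tI => h0 h1; rewrite lt_neqAle eq_sym tt0 h0 lt_neqAle tt1.
split.
  have [s ->] := pontryaginM_attained f phi (xs t) (us t) (p t) dec tI.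
  by exists s, (us t s) => //; exact: us_U.
move=> _ [s [v Uv ->]].
have [del del0 delP] := needle_dec t tIo tN.
apply: (needle_inequality ht gam0 xs_cont f_C1 phi_C1 E_itv As_E us_E xs_t0 xs_d tIo tE
  us_U Uv _ p_cont p_t1 pdot_E p_deriv pdotE minimal).
by exists del => // lam lamI; exact: delP.
Qed.
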